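(* Let $1<p<\infty$ and let $\omega:\mathbb{R}_+\to\mathbb{R}_+$ be continuous. Then: (i) $D^{1,p}_0(\mathbb{R}_+,\omega)=\mathcal{R}^0_{p,\omega}(0)\iff\omega\in B_p(0)\setminus B_p(\infty)$. (ii) $D^{1,p}_0(\mathbb{R}_+,\omega)=\mathcal{R}^\infty_{p,\omega}(0)\iff\omega\in B_p(\infty)\setminus B_p(0)$. (iii) $D^{1,p}_0(\mathbb{R}_+,\omega)=D^{1,p}(\mathbb{R}_+,\omega)\iff\omega\notin B_p(0)\cup B_p(\infty)$. (iv) $D^{1,p}_0(\mathbb{R}_+,\omega)=\mathcal{R}^0_{p,\omega}(0)\cap\mathcal{R}^\infty_{p,\omega}(0)\iff\omega\in B_p(0)\cap B_p(\infty)$.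
   Context: $\mathbb{R}_+=(0,\infty)$. $\omega\in B_p(0)$ means $\int_0^1\omega^{-1/(p-1)}\,d\tau<\infty$; $\omega\in B_p(\infty)$ means $\int_1^\infty\omega^{-1/(p-1)}\,d\tau<\infty$. $L^p(\mathbb{R}_+,\omega)$ is the space of measurable $f$ with $\|f\|_{L^p(\mathbb{R}_+,\omega)}=\big(\int_0^\infty|f|^p\omega\,dt\big)^{1/p}<\infty$. The weighted Dirichlet space $D^{1,p}(\mathbb{R}_+,\omega)$ consists of all locally absolutely continuous $u:\mathbb{R}_+\to\mathbb{R}$ with $\|u'\|_{L^p(\mathbb{R}_+,\omega)}<\infty$. $D^{1,p}_0(\mathbb{R}_+,\omega)$ is the set of all $u\in D^{1,p}(\mathbb{R}_+,\omega)$ for which there is a sequence $\{\phi_n\}\subseteq C_0^\infty(\mathbb{R}_+)$ (smooth functions with compact support in $(0,\infty)$) such that $\phi_n'\to u'$ in $L^p(\mathbb{R}_+,\omega)$ and $\phi_n\to u$ uniformly on compact subsets of $\mathbb{R}_+$. Further, $$\mathcal{R}^0_{p,\omega}(0)=\Big\{u\in D^{1,p}(\mathbb{R}_+,\omega):\ u(t)=\int_0^t u'(\tau)\,d\tau\ \text{ for all }t>0\Big\},$$ $$\mathcal{R}^\infty_{p,\omega}(0)=\Big\{u\in D^{1,p}(\mathbb{R}_+,\omega):\ u(t)=\int_t^\infty v(\tau)\,d\tau\ \text{ for all }t>0,\ \text{for some }v\in L^p(\mathbb{R}_+,\omega)\Big\}.$$ Integrals are Lebesgue integrals, so membership includes the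 requirement that $u'$ be integrable near $0$ (respectively that $v$ be integrable near $\infty$). *)

(* Defs.v *)
From HB Require Import structures.
From mathcomp Require Import all_boot all_order all_algebra.
From mathcomp Require Import all_classical all_reals all_analysis.

Set Implicit Arguments.
Unset Strict Implicit.
Unset Printing Implicit Defensive.

Import Order.TTheory GRing.Theory Num.Theory.
Import numFieldNormedType.Exports.

Local Open Scope ring_scope.
Local Open Scope classical_set_scope.

(* A function on R_+ = (0, +oo) is represented by a total function R -> R.
   Every definition below depends only on its values on R_+, so an equality
   of the sets defined here says exactly that the corresponding sets of
   functions on R_+ are equal. *)

Definition Rplus {R : realType} : set R := `]0, +oo[.

Section WeightedDirichlet.
Context {R : realType}.
Local Notation mu := (@lebesgue_measure R).
Implicit Types (p : R) (w f u : R -> R).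

Definition Bp_zero p : set (R -> R) :=
  [set w | (\int[mu]_(t in `]0%R, 1%R]) (w t `^ (- (p - 1)^-1))%:E < +oo)%E].

Definition Bp_infty p : set (R -> R) :=
  [set w | (\int[mu]_(t in `[1%R, +oo[) (w t `^ (- (p - 1)^-1))%:E < +oo)%E].

Definition wLnorm p w f : \bar R :=
  ((\int[mu]_(t in Rplus) (`|f t| `^ p * w t)%:E) `^ p^-1)%E.

Definition wLp p w : set (R -> R) :=
  [set f | measurable_fun Rplus f /\ (wLnorm p w f < +oo)%E].

Definition abs_continuous_on (a b : R) u : Prop :=
  forall e : R, 0 < e -> exists2 d : R, 0 < d &
    forall (n : nat) (x y : 'I_n -> R),
      (forall i, [/\ a <= x i, x i <= y i & y i <= b]) ->
      trivIset [set: 'I_n] (fun i => `]x i, y i[%classic) ->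
      \sum_(i < n) (y i - x i) < d ->
      \sum_(i < n) `|u (y i) - u (x i)| < e.

Definition locally_abs_continuous u : Prop :=
  forall a b : R, 0 < a -> a <= b -> abs_continuous_on a b u.

(* A locally absolutely continuous u is differentiable almost everywhere on
   R_+; u^`() is its derivative there, and takes a default value on the
   remaining null set. *)
Definition Dirichlet p w : set (R -> R) :=
  [set u | locally_abs_continuous u /\ (wLnorm p w u^`() < +oo)%E].

(* C_0^oo(R_+), with functions extended by 0 to the whole line. *)
Definition test_function : set (R -> R) :=
  [set phi | let supp := closure [set x | phi x != 0] in
    [/\ forall (n : nat) (x : R), derivable phi^`(n) x 1,
        compact supp & supp `<=` Rplus]].

Definition Dirichlet0 p w : set (R -> R) :=
  [set u | Dirichlet p w u /\
    exists phi : nat -> R -> R,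
      [/\ forall n, test_function (phi n),
          wLnorm p w ((phi n)^`() \- u^`()) @[n --> \oo] --> 0%E &
          forall K : set R, compact K -> K `<=` Rplus ->
            {uniform K, phi @ \oo --> u}]].

Definition Rzero p w : set (R -> R) :=
  [set u | Dirichlet p w u /\
    forall t : R, 0 < t ->
      mu.-integrable `]0, t] (EFin \o u^`()) /\
      u t = \int[mu]_(s in `]0, t]) derive1 u s].

Definition Rinfty p w : set (R -> R) :=
  [set u | Dirichlet p w u /\
    exists2 v : R -> R, wLp p w v &
      forall t : R, 0 < t ->
        mu.-integrable `[t, +oo[ (EFin \o v) /\
        u t = \int[mu]_(s in `[t, +oo[) v s].

End WeightedDirichlet.

(* Main.v *)
Require Import Defs.
From HB Require Import structures.
From mathcomp Require Import all_boot all_order all_algebra.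
From mathcomp Require Import all_classical all_reals all_analysis.
From mathcomp Require Import measurable_realfun.
From mathcomp Require Import ring lra.
Import Order.TTheory GRing.Theory Num.Theory.
Import numFieldNormedType.Exports.
Set Implicit Arguments.
Unset Strict Implicit.
Unset Printing Implicit Defensive.
Local Open Scope ring_scope.
Local Open Scope classical_set_scope.

(** Put [sigma = w ^ (-1/(p-1))] and call [int |f|^p w] over the half-line the
    energy of [f], so that membership in the Dirichlet space is finiteness of
    the energy of [u'].

    The link between the two integrability conditions and the energy is the
    pointwise inequality [a <= l^(p-1) a^p w + sigma / l], valid for [a >= 0]
    and [l > 0] ([norm_le_energy_conj_weight]).  On a set over which [sigma] is
    integrable, functions of finite energy are therefore integrable, and
    convergence in energy forces convergence of the integrals.  If [sigma] is
    integrable near [0], one may pass to the limit in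
    [phi_n t = int_0^t phi_n'], so an element of the closure of the test
    functions is the integral of its derivative from [0]; symmetrically at
    infinity ([Dirichlet0_limit]).

    If on the contrary [sigma] is not integrable near [0], a suitable multiple
    of [sigma] on an interval of large [sigma]-mass has any prescribed integral
    and as little energy as desired ([large_mass_cheap], [fills_divergent]):
    the value of [u] near [0] can be reached from [0] at no cost, and no
    boundary condition survives in the closure.  Consequently [u] lies in the
    closure as soon as, at each of the two ends, either [sigma] is not
    integrable or [u] tends to [0].  One keeps [u'] on a large compact
    interval, joins its two ends to [0] cheaply, smooths the result and
    integrates it ([approximating_test_function], [Dirichlet0_criterion]).

    This determines the closure in each of the four cases.  The equivalences
    follow because the four candidate spaces are pairwise different whatever
    the weight: a constant lies in neither integral space, a smooth step from
    [0] to [1] lies only in the first and one minus this step only in the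
    second.

    Two ingredients are of independent interest.  The fundamental theorem of
    calculus for a locally absolutely continuous [u] ([locally_ac_ftc]) is
    obtained by writing [u] as a difference of monotone absolutely continuous
    functions, namely its total variation [V] and [V - u]; the
    Lebesgue-Stieltjes measure of such a function is dominated by Lebesgue
    measure, its Radon-Nikodym density recovers [u] by integration, and
    Lebesgue differentiation identifies the density with [u'].  The density of
    smooth functions in energy ([smooth_dense]) goes through truncation,
    approximation in mean by continuous functions, and a smooth partition of
    unity. *)

(** * Finite families of intervals and total variation *)

Section Lists.
Context {R : realType}.
Implicit Types (p q : R * R) (l : seq (R * R)) (u : R -> R).

(** The relation is stated on endpoints, so that it is decidable and inherited
    by subintervals. It is stronger than disjointness of the open intervals
    when an interval is degenerate. *)
Definition disj p q := (p.2 <= q.1) || (q.2 <= p.1).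
Definition admissible l := all (fun p => p.1 <= p.2) l && pairwise disj l.
Definition tlen l := \sum_(p <- l) (p.2 - p.1).
Definition tvar u l := \sum_(p <- l) `|u p.2 - u p.1|.
(** Absolute continuity on the whole line, with lists instead of indexed
    families: replacing one interval by the pieces of a partition is then a
    concatenation. Functions on a compact interval are extended by constants,
    see [abs_continuous_on_ac_seq]. *)
Definition ac_seq u := forall e : R, 0 < e -> exists2 d : R, 0 < d &
  forall l, admissible l -> tlen l < d -> tvar u l < e.

Lemma disj_sym p q : disj p q = disj q p.
Proof. by rewrite /disj orbC. Qed.

Lemma disj_sub p q r : r.1 <= p.1 -> p.2 <= r.2 -> disj r q -> disj p q.
Proof.
move=> h1 h2 /orP[h|h]; apply/orP; [left; exact: le_trans h|right; exact: le_trans h1].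
Qed.

Definition pieces (x : R) (s : seq R) := zip (x :: s) s.

Lemma pieces_tlen x s : tlen (pieces x s) = last x s - x.
Proof.
rewrite /tlen /pieces; elim: s x => [|y s IH] x /=; first by rewrite big_nil subrr.
by rewrite big_cons IH /=; ring.
Qed.

Lemma pieces_tvar x s b u : tvar u (pieces x s) = variation x b u s.
Proof.
rewrite /tvar /pieces; elim: s x => [|y s IH] x /=.
  by rewrite big_nil /variation/= big_nil.
rewrite big_cons IH /variation /= big_nat_recl//=.
Qed.

Lemma pieces_in x s : path <%R x s ->
  all (fun p => [&& p.1 <= p.2, x <= p.1 & p.2 <= last x s]) (pieces x s).
Proof.
elim: s x => [//|y s IH] x /= /andP[xy ys].
have yl : y <= last y s.
  by elim: (s) (y) ys => [//|z t I] w /= /andP[/ltW wz /I]; exact: le_trans.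
rewrite lexx ltW//= yl/=.
apply: sub_all (IH _ ys) => p /and3P[-> h ->]; rewrite andbT.
exact: le_trans (ltW xy) h.
Qed.

Lemma pieces_admissible x s : path <%R x s -> admissible (pieces x s).
Proof.
move=> xs; apply/andP; split.
  by apply: sub_all (pieces_in xs) => p /and3P[].
elim: s x xs => [//|y s IH] x /= /andP[xy ys].
rewrite IH// andbT; apply: sub_all (pieces_in ys) => p /and3P[_ h _].
by rewrite /disj/= h.
Qed.

(** Cutting one interval of the family at the points of a partition changes
    neither disjointness nor total length. *)
Lemma admissible_replace p l x s : x = p.1 -> last x s = p.2 -> path <%R x s ->
  admissible (p :: l) -> admissible (l ++ pieces x s) /\
    tlen (l ++ pieces x s) = tlen (p :: l).
Proof.
move=> xp sp xs /andP[/= /andP[p12 al] /andP[pl pwl]].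
split; last by rewrite /tlen big_cat big_cons/= -!/(tlen _) pieces_tlen sp xp addrC.
apply/andP; split.
  by rewrite all_cat al/=; have /andP[] := pieces_admissible xs.
rewrite pairwise_cat pwl/=; have /andP[_ ->] := pieces_admissible xs.
rewrite andbT; apply/allrelP => q r ql rs.
have /allP /(_ _ rs) /and3P[_ h1 h2] := pieces_in xs.
rewrite disj_sym; apply: (@disj_sub _ _ p); rewrite -?xp -?sp//.
by move/allP : pl; apply.
Qed.

Lemma admissible_cons p l : admissible (p :: l) -> p.1 <= p.2 /\ admissible l.
Proof. by case/andP => /= /andP[-> al] /andP[_ pl]; split => //; rewrite /admissible al. Qed.

Lemma tlen_cons p l : tlen (p :: l) = p.2 - p.1 + tlen l.
Proof. by rewrite /tlen big_cons. Qed.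

(** The bound on increments passes to total variations, one interval at a
    time: the first list holds the intervals whose variation is already
    counted, the second one those still counted by their increments. A total
    variation is a supremum over partitions, and each partition moves its
    pieces to the second list. *)
Lemma total_variation_admissible u (d e : R) :
  (forall l, admissible l -> tlen l < d -> tvar u l <= e) ->
  forall l1 l2, admissible (l1 ++ l2) -> tlen (l1 ++ l2) < d ->
  (\sum_(p <- l1) total_variation p.1 p.2 u + (tvar u l2)%:E <= e%:E)%E.
Proof.
move=> H; elim => [|p l1 IH] l2 /= al tl.
  by rewrite big_nil add0e lee_fin; exact: H.
have [p12 al'] := admissible_cons al.
have tl' : tlen (l1 ++ l2) < d.
  apply: le_lt_trans tl; rewrite tlen_cons -{1}[tlen _]add0r lerD2r.
  by rewrite subr_ge0.
rewrite big_cons -addrA; set A := (X in (_ + X <= _)%E).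
have [p12E|p12'] := eqVneq p.1 p.2.
  by rewrite p12E total_variationxx add0e; exact: IH.
have ltp : p.1 < p.2 by rewrite lt_neqAle p12' p12.
have Afin : A \is a fin_num.
  rewrite ge0_fin_numE; last first.
    rewrite adde_ge0 ?lee_fin ?sumr_ge0// big_seq sume_ge0// => q ql.
    apply: total_variation_ge0.
    by case/andP: al' => /allP + _; apply; rewrite mem_cat ql.
  by apply: le_lt_trans (IH _ al' tl') _; rewrite ltry.
rewrite -leeBrDr//; apply: ge_ereal_sup => _ [_ [s [ps /eqP ls] <-] <-].
have tvE : tvar u (l2 ++ pieces p.1 s) = tvar u l2 + variation p.1 p.2 u s.
  by rewrite -(pieces_tvar p.1 s p.2 u) /tvar big_cat.
have -> : (variation p.1 p.2 u s)%:E = ((tvar u (l2 ++ pieces p.1 s))%:E - (tvar u l2)%:E)%E.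
  by rewrite tvE -EFinB; congr EFin; ring.
rewrite leeBrDr// /A -EFinB.
rewrite [X in (X <= _)%E](_ : _ = (\sum_(q <- l1) total_variation q.1 q.2 u + (tvar u (l2
  ++ pieces p.1 s))%:E)%E); last first.
  by rewrite addrCA -EFinD subrK.
have [a1 a2] := admissible_replace erefl ls ps al.
by apply: IH; rewrite catA// a2.
Qed.

Lemma ac_seq_total_variation u : ac_seq u -> forall e : R, 0 < e ->
  exists2 d : R, 0 < d & forall l, admissible l -> tlen l < d ->
    (\sum_(p <- l) total_variation p.1 p.2 u <= e%:E)%E.
Proof.
move=> acu e e0; have [d d0 h] := acu e e0; exists d => // l al tl.
have := @total_variation_admissible u d e _ l [::].
rewrite cats0 /tvar big_nil adde0; apply => // l' al' tl'.
exact/ltW/h.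
Qed.

(** On intervals shorter than the [d] given by [e = 1] the variation is at
    most [1], and finitely many of them cover [[a, b]]. *)
Lemma ac_seq_bounded_variation u a b : a <= b -> ac_seq u -> bounded_variation a b u.
Proof.
move=> ab acu; apply/bounded_variationP => //.
have [d d0 h] := ac_seq_total_variation acu ltr01.
have step x y : x <= y -> y - x < d -> (total_variation x y u <= 1)%E.
  move=> xy yx; have := h [:: (x, y)].
  rewrite big_seq1; apply; last by rewrite /tlen big_seq1.
  by rewrite /admissible/= xy.
have key : forall n x, a <= x -> x - a <= (d / 2) *+ n ->
    (total_variation a x u <= n%:R%:E)%E.
  elim => [|n IH] x ax xa.
    have -> : x = a by apply/eqP; rewrite eq_le ax andbT -subr_le0.
    by rewrite total_variationxx.
  have [ax'|xa'] := leP (x - d / 2) a.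
    apply: le_trans (step _ _ ax _) _; last by rewrite lee_fin ler1n.
    by rewrite ltrBlDr; lra.
  have dd : 0 < d / 2 by rewrite divr_gt0.
  rewrite (@total_variationD _ _ _ (x - d / 2)); [|exact: ltW|by rewrite lerBlDr lerDl ltW].
  rewrite -(natr1 n) EFinD; apply: leeD.
    apply: IH; first exact: ltW.
    by move: xa; rewrite mulrSr; lra.
  by apply: step; rewrite ?lerBlDr ?lerDl ?ltW//; lra.
rewrite ge0_fin_numE ?total_variation_ge0//.
have [n hn] : exists n, b - a <= (d / 2) *+ n.
  exists (Num.bound ((b - a) / (d / 2))).
  rewrite -mulr_natl -ler_pdivrMr; last lra.
  by apply/ltW/archi_boundP; rewrite divr_ge0 ?subr_ge0// divr_ge0// ltW.
by apply: le_lt_trans (key n b ab hn) _; rewrite ltry.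
Qed.

End Lists.

(** * Absolutely continuous Stieltjes measures *)

Section AC_measure.
Context {R : realType}.
Variable F : cumulative R R.
Hypothesis acF : ac_seq F.
Local Notation mu := (@lebesgue_measure R).
Local Notation lam := (lebesgue_stieltjes_measure F).

Lemma lebesgue_stieltjes_oc (G : cumulative R R) (a b : R) : a <= b ->
  lebesgue_stieltjes_measure G `]a, b]%classic = (G b - G a)%:E.
Proof.
move=> ab; rewrite /lebesgue_stieltjes_measure /measure_extension/=.
by rewrite measurable_mu_extE/=; [exact: wlength_itv_bnd|exact: is_ocitv].
Qed.

(** A set of the ring generated by half-open intervals is a finite disjoint
    union of such intervals, on which the Stieltjes mass is the sum of the
    increments of [F] and the Lebesgue mass the sum of the lengths. *)
Lemma lebesgue_stieltjes_small (e : R) : 0 < e -> exists2 d : R, 0 < d &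
  forall A : set (SetRing.type (ocitv_type R)),
    (R.-ocitv.-ring).-measurable A ->
    (mu A < d%:E)%E -> (lam A <= e%:E)%E.
Proof.
move=> e0; have [d d0 H] := acF e0; exists d => // A mA Ad.
(* The empty set is its own decomposition, and endpoints chosen for an empty
   interval could lie inside another one. *)
have [A0|/set0P A0] := eqVneq A set0; first by rewrite A0 measure0 lee_fin ltW.
pose D := SetRing.decomp A.
have finD : finite_set D := SetRing.decomp_finite_set A.
pose P (X : set R) (p : R * R) := p.1 <= p.2 /\ X = `]p.1, p.2]%classic.
pose ep (X : set R) := xget (0, 0) (P X).
have epP X : D X -> P X (ep X).
  move=> DX; have : (R.-ocitv).-measurable X.
    by apply: SetRing.decomp_measurable mA _; rewrite inE.
  move=> /ocitvP[X0|[x x12 Xx]].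
    by have := SetRing.all_decomp_neq0 A0 DX; rewrite X0 => -[].
  by apply: (@xgetPex _ (0, 0) (P X)); exists x; split => //; exact: ltW.
pose l := [seq ep X | X <- finmap.enum_fset (fset_set D)].
have memD X : (X \in finmap.enum_fset (fset_set D)) -> D X.
  by move=> h; apply: set_mem; rewrite -in_fset_set.
have al : admissible l.
  apply/andP; split.
    by apply/allP => _ /mapP[X /memD /epP[h _] ->].
  rewrite pairwise_map.
  have := finmap.fset_uniq (fset_set D); rewrite uniq_pairwise.
  apply: (@sub_in_pairwise _ (mem (finmap.enum_fset (fset_set D)))); last exact/allP.
  move=> X Y /memD DX /memD DY /= XY.
  have [[x12 XE] [y12 YE]] := (epP X DX, epP Y DY).
  have XY0 : X `&` Y = set0.
    have /trivIsetP := @SetRing.decomp_triv _ _ A.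
    by apply => //.
  have [x Xx] := SetRing.all_decomp_neq0 A0 DX.
  have [y Yy] := SetRing.all_decomp_neq0 A0 DY.
  move: Xx Yy XY0; move: (ep X) (ep Y) XE YE x12 y12 => p q -> -> p12 q12.
  move=> Xx Yy XY0; move: Xx Yy; rewrite /= !in_itv/= => /andP[px xp] /andP[qy yq].
  rewrite /disj; apply: contrapT => /negP; rewrite negb_or -!ltNge => /andP[h1 h2].
  have : (`]p.1, p.2] `&` `]q.1, q.2]) (Num.min p.2 q.2).
    have pp := lt_le_trans px xp; have qq := lt_le_trans qy yq.
    by split; rewrite /= in_itv/= ge_min lt_min ?h1 ?h2 ?pp ?qq ?lexx ?orbT.
  by rewrite XY0.
have sumE (G : cumulative R R) : lebesgue_stieltjes_measure G A =
  (\sum_(p <- l) (G p.2 - G p.1))%:E.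
  rewrite -{1}(SetRing.cover_decomp A) measure_fin_bigcup//=; last 2 first.
  - exact: SetRing.decomp_triv.
  - move=> X DX; have [_ ->] := epP X DX; exact: measurable_itv.
  rewrite fsbig_finite//= /l big_map -sumEFin.
  rewrite big_seq [RHS]big_seq; apply: eq_bigr => X /memD /epP[h {1}->].
  exact: lebesgue_stieltjes_oc.
rewrite (sumE F) lee_fin; apply: ltW; apply: le_lt_trans (H l al _); last first.
  by move: Ad; rewrite [mu A](sumE idfun) lte_fin.
by apply: ler_sum => p _; exact: ler_norm.
Qed.

(** A Lebesgue-null set is covered by half-open intervals of small total
    length; the finite unions of the cover belong to the ring and have
    uniformly small Stieltjes mass. *)
Lemma lebesgue_stieltjes_dominated : lam `<< mu.
Proof.
apply/null_content_dominatesP => N mN muN0.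
apply/eqP; rewrite eq_le measure_ge0 andbT; apply/lee_addgt0Pr => e e0.
rewrite add0e.
have [d d0 H] := lebesgue_stieltjes_small e0.
have /lb_ereal_inf_adherent : mu N \is a fin_num by rewrite muN0.
move=> /(_ _ d0) [_ [A [mA NA] <-]]; rewrite -[ereal_inf _]/(mu N) muN0 add0e => Ad.
have mAs i : measurable (A i : set (measurableTypeR R)) by exact: sub_sigma_algebra.
pose B n := \big[setU/set0]_(i < n) A i.
have mB n : measurable (B n : set (measurableTypeR R)) by exact: bigsetU_measurable.
have mUA : measurable (\bigcup_n B n : set (measurableTypeR R)) by exact: bigcupT_measurable.
have UB : \bigcup_n B n = \bigcup_n A n.
  apply/seteqP; split => [x [n _]|x [n _ Anx]].
    exact: bigsetU_bigcup.
  by exists n.+1 => //; rewrite /B big_ord_recr/=; right.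
apply: (@le_trans _ _ (lam (\bigcup_n B n))).
  by apply: le_measure; rewrite ?inE// UB.
have cv : (lam \o B) n @[n --> \oo] --> lam (\bigcup_n B n).
  apply: nondecreasing_cvg_mu => //; move=> n m nm; apply/subsetPset.
  exact: subset_bigsetU.
apply: cvge_le cv; apply: nearW => n /=.
have mBr : (R.-ocitv.-ring).-measurable (B n : set (SetRing.type (ocitv_type R))).
  by apply: bigsetU_measurable => i _; apply: sub_gen_smallest; exact: mA.
apply: H => //; apply: le_lt_trans Ad.
apply: (@le_trans _ _ (\sum_(i < n) mu (A i))%E).
  by apply: Boole_inequality => i _; exact: mAs.
rewrite -(big_mkord xpredT (fun i => mu (A i))).
apply: le_trans (nneseries_lim_ge n _) _; first by move=> *; exact: measure_ge0.
rewrite le_eqVlt; apply/orP; left; apply/eqP; apply: eq_eseriesr => i _.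
by rewrite -measurable_mu_extE.
Qed.
End AC_measure.

(** * Densities of absolutely continuous functions *)

Section ac_seq_theory.
Context {R : realType}.
Local Notation mu := (@lebesgue_measure R).
Implicit Types (u f g : R -> R) (a b x y : R).

Lemma ac_seq_continuous u : ac_seq u -> continuous u.
Proof.
move=> acu x; apply/cvgrPdist_lt => e e0; have [d d0 H] := acu e e0.
near=> y.
have : tvar u [:: (Num.min x y, Num.max x y)] < e.
  apply: H; first by rewrite /admissible/= le_max ge_min lexx.
  rewrite /tlen big_seq1/=.
  have h1 : y < x + d by near: y; apply: lt_nbhsl; rewrite ltrDl.
  have h2 : - y < d - x by near: y; apply: Nlt_nbhsl; rewrite ltrDr.
  by rewrite /Num.min /Num.max/=; case: (ltP x y) => _; lra.
rewrite /tvar big_seq1/= /Num.min /Num.max/=; case: (ltP x y) => // _.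
by rewrite distrC.
Unshelve. all: by end_near. Qed.

(** Such maps send admissible lists to admissible lists of no larger length,
    hence preserve absolute continuity under composition. *)
Definition short_homo (phi : R -> R) :=
  forall x y, x <= y -> 0 <= phi y - phi x <= y - x.

Definition map_itv (phi : R -> R) (l : seq (R * R)) :=
  [seq (phi p.1, phi p.2) | p <- l].

Lemma admissible_map phi l : short_homo phi -> admissible l ->
  admissible (map_itv phi l) /\ tlen (map_itv phi l) <= tlen l.
Proof.
move=> sphi /andP[al pl]; split; last first.
  rewrite /tlen big_map big_seq [leRHS]big_seq; apply: ler_sum => p pl'.
  by move/allP : al => /(_ _ pl') /sphi /andP[].
apply/andP; split.
  rewrite all_map; apply: sub_all al => p /sphi /= /andP[+ _].
  by rewrite subr_ge0.
rewrite pairwise_map; apply: sub_pairwise pl => p q /orP[|] /sphi /andP[+ _];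
 by rewrite subr_ge0 /disj/= => ->; rewrite ?orbT.
Qed.

Lemma ac_seq_comp u phi : short_homo phi -> ac_seq u -> ac_seq (u \o phi).
Proof.
move=> sphi acu e e0; have [d d0 H] := acu e e0; exists d => // l al tl.
have [al' tl'] := admissible_map sphi al.
have := H _ al' (le_lt_trans tl' tl).
by rewrite /tvar big_map.
Qed.

Lemma ac_seqB u v : ac_seq u -> ac_seq v -> ac_seq (u \- v).
Proof.
move=> acu acv e e0; have e20 : 0 < e / 2 by rewrite divr_gt0.
have [d d0 H] := acu _ e20; have [d' d'0 H'] := acv _ e20.
exists (Num.min d d'); first by rewrite lt_min d0.
move=> l al; rewrite lt_min => /andP[/(H _ al) h /(H' _ al) h'].
rewrite (splitr e); apply: le_lt_trans (ltrD h h').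
rewrite /tvar -big_split/=; apply: ler_sum => p _.
have -> : (u \- v) p.2 - (u \- v) p.1 = (u p.2 - u p.1) - (v p.2 - v p.1).
  by rewrite /=; ring.
exact: ler_normB.
Qed.

Lemma max_short_homo a : short_homo (Num.max a).
Proof.
move=> x y xy; rewrite /Num.max/=; case: (ltP a x) => h1; case: (ltP a y) => h2; lra.
Qed.

Definition clip a b x := Num.max a (Num.min x b).

Lemma clip_short_homo a b : short_homo (clip a b).
Proof.
move=> x y xy; rewrite /clip /Num.max /Num.min/=.
by case: (ltP x b) => h3; case: (ltP y b) => h4; case: ltP => h1; case: ltP => h2; lra.
Qed.

Lemma clip_in a b x : a <= b -> a <= clip a b x <= b.
Proof. by move=> ab; rewrite /clip le_max lexx/= ge_max ab/= ge_min lexx orbT. Qed.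

Lemma clip_id a b x : a <= x <= b -> clip a b x = x.
Proof. by move=> /andP[ax xb]; rewrite /clip min_l// max_r. Qed.

Lemma continuous_clip a b : continuous (clip a b).
Proof.
move=> x; apply: (@continuous_max _ _ (cst a) (Num.min ^~ b)); first exact: cvg_cst.
by apply: (@continuous_min _ _ id (cst b)); [exact: cvg_id|exact: cvg_cst].
Qed.

Lemma clip_dist a b x y : `|clip a b x - clip a b y| <= `|x - y|.
Proof.
wlog xy : x y / x <= y.
  move=> wl; have [/wl//|/ltW/wl] := leP x y.
  by rewrite distrC [`|y - x|]distrC.
have /andP[h1 h2] := clip_short_homo a b xy.
by rewrite distrC [`|x - y|]distrC !ger0_norm// subr_ge0.
Qed.

Lemma clip_error (N x : R) : 0 <= N -> `|x - clip (- N) N x| <= `|x|.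
Proof.
move=> N0; rewrite /clip /Num.max /Num.min/=.
have [x0|x0] := leP 0 x; last first.
  rewrite (ltr0_norm x0) ler_norml.
  by case: (ltP x N) => h1; case: ltP => h2; apply/andP; split; lra.
rewrite (ger0_norm x0) ler_norml.
by case: (ltP x N) => h1; case: ltP => h2; apply/andP; split; lra.
Qed.

Lemma nondecreasing_ac_density (F : R -> R) a b :
  {homo F : x y / x <= y} -> ac_seq F -> a <= b ->
  exists2 g : R -> R, mu.-integrable setT (EFin \o g) &
    forall x, a <= x <= b -> F x - F a = \int[mu]_(t in `]a, x]) g t.
Proof.
move=> ndF acF ab.
have rcF : right_continuous F by apply/right_continuousW/ac_seq_continuous.
pose Fm := isCumulative.Build R _ R F ndF rcF.
pose Fc : cumulative R R := HB.pack F Fm.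
have acFc : ac_seq Fc by [].
pose lam := lebesgue_stieltjes_measure Fc.
have mE : measurable (`]a, b]%classic : set (measurableTypeR R)) by exact: measurable_itv.
have lamfin : (lam `]a, b]%classic < +oo)%E.
  by rewrite /lam lebesgue_stieltjes_oc// ltry.
pose nu : {finite_measure set (measurableTypeR R) -> \bar R} := mfrestr mE lamfin.
have nud : nu `<< mu.
  apply/null_content_dominatesP => A mA muA.
  apply/eqP; rewrite eq_le measure_ge0 andbT.
  have /null_content_dominatesP/(_ _ mA muA) lA := lebesgue_stieltjes_dominated acFc.
  rewrite /nu/= /mfrestr/= /mrestr -lA; apply: le_measure; rewrite ?inE//.
  exact: measurableI.
have [f [f0 ffin fint fE]] := radon_nikodym_sigma_finite nud.
exists (fine \o f).
  by apply: eq_integrable fint => // x _ /=; rewrite fineK.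
move=> x /andP[ax xb].
rewrite /Rintegral; under eq_integral => t _ do rewrite /= fineK//.
rewrite -fE; last exact: measurable_itv.
rewrite /nu/= /mfrestr/= /mrestr (_ : _ `&` _ = `]a, x]%classic); last first.
  apply/setIidl => t /=; rewrite !in_itv/= => /andP[-> tx]; exact: le_trans xb.
by rewrite lebesgue_stieltjes_oc.
Qed.

(** The total variation [V] of [u] from [a] is nondecreasing and absolutely
    continuous, and so is [V - u] because the variation dominates the
    increments of [u]. *)
Lemma ac_seq_density u a b : ac_seq u -> a <= b ->
  exists2 f : R -> R, mu.-integrable setT (EFin \o f) &
    forall x, a <= x <= b -> u x - u a = \int[mu]_(t in `]a, x]) f t.
Proof.
move=> acu ab.
have bv c d : c <= d -> total_variation c d u \is a fin_num.
  by move=> cd; apply/bounded_variationP => //; exact: ac_seq_bounded_variation.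
pose V x := fine (total_variation a (Num.max a x) u).
have Vd x y : x <= y ->
    V y - V x = fine (total_variation (Num.max a x) (Num.max a y) u).
  move=> xy; have mxy : Num.max a x <= Num.max a y.
    by have /andP[] := max_short_homo a xy; rewrite subr_ge0.
  have am : a <= Num.max a x by rewrite le_max lexx.
  by rewrite /V (total_variationD u am mxy) fineD ?bv//; ring.
have V_ge x y : x <= y -> `|u (Num.max a y) - u (Num.max a x)| <= V y - V x.
  move=> xy; have mxy : Num.max a x <= Num.max a y.
    by have /andP[] := max_short_homo a xy; rewrite subr_ge0.
  by rewrite Vd// -lee_fin fineK ?bv// total_variation_ge.
have ndV : {homo V : x y / x <= y}.
  by move=> x y /V_ge h; rewrite -subr_ge0; exact: le_trans h.
have acV : ac_seq V.
  move=> e e0; have e20 : 0 < e / 2 by rewrite divr_gt0.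
  have [d d0 H] := ac_seq_total_variation acu e20; exists d => // l al tl.
  have [al' tl'] := admissible_map (max_short_homo a) al.
  have := H _ al' (le_lt_trans tl' tl); rewrite /map_itv big_map/= => h.
  have -> : e = e / 2 + e / 2 by rewrite -splitr.
  apply: ltr_pwDr => //; rewrite -lee_fin; apply: le_trans h.
  rewrite /tvar -sumEFin big_seq [leRHS]big_seq.
  case/andP: al => /allP al _.
  apply: lee_sum => p /al p12; rewrite ger0_norm ?subr_ge0 ?ndV// Vd//.
  rewrite fineK// bv//.
  by have /andP[] := max_short_homo a p12; rewrite subr_ge0.
pose W := V \- (u \o Num.max a).
have ndW : {homo W : x y / x <= y}.
  move=> x y /V_ge h; rewrite -subr_ge0 /W/=.
  have := le_trans (ler_norm _) h; lra.
have acW : ac_seq W by apply: ac_seqB => //; apply: ac_seq_comp => //; exact: max_short_homo.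
have [g ig gE] := nondecreasing_ac_density ndV acV ab.
have [h ih hE] := nondecreasing_ac_density ndW acW ab.
exists (g \- h).
  have := integrableB measurableT ig ih; apply: eq_integrable => //.
move=> x xab; rewrite RintegralB//.
- rewrite -gE// -hE// /W/=.
  by case/andP : xab => ax xb; rewrite !max_r//; ring.
- by apply: integrableS ig.
- by apply: integrableS ih.
Qed.

End ac_seq_theory.

(** * Measurability of the derivative of a continuous function *)

Section measurable_derive.
Context {R : realType}.
Implicit Types (u f g : R -> R) (a b x y : R).

Lemma invSn_lt (e : R) : 0 < e -> exists n : nat, n.+1%:R^-1 < e.
Proof.
move=> e0; exists (Num.bound e^-1); rewrite invf_plt ?posrE//.
apply: (@lt_trans _ _ (Num.bound e^-1)%:R); last by rewrite ltr_nat.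
by apply: archi_boundP; rewrite invr_ge0 ltW.
Qed.

Let dq u h x := h^-1 * (u (h + x) - u x).

(** By completeness, differentiability is a Cauchy condition on difference
    quotients. In this form it only involves the values of [u], which makes it
    a countable combination of closed conditions on [x] when [u] is
    continuous. *)
Lemma derivable_cauchy u x : derivable u x 1 <->
  forall k : nat, exists m : nat, forall h1 h2 : R,
    0 < `|h1| < m.+1%:R^-1 -> 0 < `|h2| < m.+1%:R^-1 ->
    `|dq u h1 x - dq u h2 x| <= k.+1%:R^-1.
Proof.
have dE : (fun h => h^-1 *: (u (h *: 1 + x) - u x)) = (fun h => dq u h x).
  by apply/funext => h; rewrite /dq [h *: 1]mulr1.
rewrite /derivable dE; split.
  move=> cq k; pose l := lim (dq u h x @[h --> 0^']).
  have k0 : (0 : R) < k.+1%:R^-1 / 2 by rewrite divr_gt0 ?invr_gt0.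
  move/cvgrPdist_lt : cq => /(_ _ k0); rewrite near_withinE/=.
  move=> [d /= d0 H].
  have [m md] : exists m : nat, m.+1%:R^-1 < d by exact: invSn_lt.
  exists m => h1 h2 /andP[h10 h1m] /andP[h20 h2m].
  have P h : 0 < `|h| -> `|h| < m.+1%:R^-1 -> `|l - dq u h x| < k.+1%:R^-1 / 2.
    move=> h0 hm; apply: H; rewrite /= ?sub0r ?normrN ?(lt_trans hm)//.
    by rewrite -normr_gt0.
  rewrite (splitr k.+1%:R^-1) ltW// (le_lt_trans _ (ltrD (P _ h10 h1m) (P _ h20 h2m)))//.
  rewrite [`|l - dq u h1 x|]distrC; apply: le_trans (ler_normD _ _).
  by rewrite addrA subrK.
move=> H; apply/cauchy_cvgP/cauchy_ballP => e e0.
have [k ke] : exists k : nat, k.+1%:R^-1 < e by exact: invSn_lt.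
have [m Hm] := H k.
have N : \forall h \near (0:R)^', 0 < `|h| < m.+1%:R^-1.
  rewrite near_withinE; exists m.+1%:R^-1 => /=; first by rewrite invr_gt0.
  by move=> h /=; rewrite sub0r normrN => hm h0; rewrite normr_gt0 h0.
rewrite near_map2; exists ([set h | 0 < `|h| < m.+1%:R^-1], [set h | 0 < `|h| <
  m.+1%:R^-1]) => //.
move=> [h1 h2] /= [? ?]; rewrite -ball_normE /=.
by apply: le_lt_trans ke; exact: Hm.
Qed.

Lemma derive1_not_derivable u x : ~ derivable u x 1 -> u^`() x = point.
Proof.
move=> nd; rewrite derive1E /derive; apply: dvgP => //.
Qed.

(** Outside of the Borel set of differentiability points the derivative is a
    constant default value; on that set it is the pointwise limit of the
    difference quotients with increment [1 / (n + 1)]. *)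
Lemma measurable_derive1 u : continuous u -> measurable_fun setT u^`().
Proof.
move=> cu.
have cdq h : continuous (dq u h).
  move=> x; apply: cvgM; first exact: cvg_cst.
  apply: cvgB; last exact: cu.
  apply: continuous_comp; last exact: cu.
  by apply: cvgD; [exact: cvg_cst|exact: cvg_id].
pose C k m := [set x | forall h1 h2 : R,
    0 < `|h1| < m.+1%:R^-1 -> 0 < `|h2| < m.+1%:R^-1 ->
    `|dq u h1 x - dq u h2 x| <= k.+1%:R^-1].
have mC k m : measurable (C k m).
  apply: closed_measurable.
  have -> : C k m = \bigcap_(h in [set h : R * R | 0 < `|h.1| < m.+1%:R^-1 /\ 0 < `|h.2| <
    m.+1%:R^-1])
      ((fun x => `|dq u h.1 x - dq u h.2 x|) @^-1` [set y | y <= k.+1%:R^-1]).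
    apply/seteqP; split => [x Cx [h1 h2] [/= H1 H2]|x Cx h1 h2 H1 H2]; first exact: Cx.
    by apply: (Cx (h1, h2)).
  apply: closed_bigI => h _; apply: preimage_closed (@closed_le _ _) => x _.
  by apply: cvg_norm; apply: cvgB; exact: cdq.
pose D := \bigcap_k \bigcup_m C k m.
have mD : measurable D by apply: bigcapT_measurable => k; exact: bigcupT_measurable.
have DE x : D x <-> derivable u x 1.
  rewrite derivable_cauchy; split => [Dx k|H k _].
    by have [m _ Cm] := Dx k I; exists m.
  by have [m Hm] := H k; exists m.
rewrite -(setUv D); apply/measurable_funU => //; first exact: measurableC.
split.
  apply: (@measurable_fun_cvg _ _ _ _ (fun n x => dq u n.+1%:R^-1 x)) => //.
    move=> n; apply: measurable_funTS; exact: continuous_measurable_fun.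
  move=> x /DE dx.
  have : dq u h x @[h --> 0^'] --> u^`() x.
    have dE : (fun h => dq u h x) = (fun h => h^-1 *: (u (h *: 1 + x) - u x)).
      by apply/funext => h; rewrite /dq [h *: 1]mulr1.
    by rewrite dE derive1E.
  move=> /cvgr_dnbhsP; apply; split; last exact: cvg_harmonic.
  by move=> n; rewrite invr_neq0.
apply: (@eq_measurable_fun _ _ _ _ _ (cst point)) => //.
by move=> x /set_mem /= nD; rewrite derive1_not_derivable//; rewrite -DE.
Qed.
End measurable_derive.

(** * The fundamental theorem of calculus on the half-line *)

Section ftc_ac.
Context {R : realType}.
Local Notation mu := (@lebesgue_measure R).
Implicit Types (u f g : R -> R) (a b x y : R).

Lemma abs_continuous_on_ac_seq u a b : a <= b -> abs_continuous_on a b u ->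
  ac_seq (u \o clip a b).
Proof.
move=> ab acu e e0; have [d d0 H] := acu e e0; exists d => // l al tl.
have [/andP[al' pl'] tl'] := admissible_map (@clip_short_homo _ a b) al.
set l' := map_itv _ l in al' pl' tl'.
have -> : tvar (u \o clip a b) l = tvar u l' by rewrite /tvar big_map.
pose z := (0 : R, 0 : R).
have nthl' (i : 'I_(size l')) : nth z l' i \in l' by rewrite mem_nth.
have H' := H (size l') (fun i => (nth z l' i).1) (fun i => (nth z l' i).2).
rewrite /tvar (big_nth z) big_mkord; apply: H'.
- move=> i; have := allP al' _ (nthl' i); have /mapP[p _ ->] /= := nthl' i.
  by have /andP[-> _] := clip_in p.1 ab; have /andP[_ ->] := clip_in p.2 ab.
- apply/trivIsetP => i j _ _; wlog ij : i j / (i < j)%N.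
    move=> wl; rewrite neq_ltn => /orP[ij|ji]; first by apply: wl => //; rewrite neq_ltn ij.
    by rewrite setIC; apply: wl => //; rewrite neq_ltn ji.
  move=> _; move/(pairwiseP z) : pl' => /(_ i j (ltn_ord i) (ltn_ord j) ij) dij.
  apply/seteqP; split => // x [/=]; rewrite !in_itv/= => /andP[x1 x2] /andP[x3 x4].
  case/orP: dij => h.
    by have := lt_trans (lt_le_trans x2 h) x3; rewrite ltxx.
  by have := lt_trans (lt_le_trans x4 h) x1; rewrite ltxx.
- by move: (le_lt_trans tl' tl); rewrite /tlen (big_nth z) big_mkord.
Qed.

Lemma near_eq_derive1 u v x : (\forall y \near x, u y = v y) ->
  (derivable u x 1 -> derivable v x 1) /\ u^`() x = v^`() x.
Proof.
move=> uv; split; first by apply: near_eq_derivable.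
by rewrite !derive1E; apply: near_eq_derive.
Qed.

Lemma ac_ftc_density u a b : a < b -> abs_continuous_on a b u ->
  exists f, [/\ mu.-integrable setT (EFin \o f),
    forall x, a <= x <= b -> u x - u a = \int[mu]_(t in `]a, x]) f t &
    {ae mu, forall x, a < x < b -> derivable u x 1 /\ u^`() x = f x}].
Proof.
move=> ab acu.
have acv := abs_continuous_on_ac_seq (ltW ab) acu.
have [f fint fE] := ac_seq_density acv (ltW ab).
have fE' x : a <= x <= b -> u x - u a = \int[mu]_(t in `]a, x]) f t.
  by move=> xab; rewrite -fE//= !clip_id// lexx ltW.
exists f; split => //.
have floc : locally_integrable setT f by exact: open_integrable_locally openT fint.
have fy y : mu.-integrable [set` Interval (BRight a) (BRight y)] (EFin \o f).
  by apply: integrableS fint.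
have := FTC1 fy floc; apply: filterS; first exact: (ae_filter_ringOfSetsType mu).
move=> x /= H /andP[ax xb].
have [d dE] := H ax.
have ux : \forall y \near x, (\int[mu]_(t in `]a, y]) f t) + u a = u y.
  near=> y; rewrite -fE' ?subrK//; apply/andP; split; apply: ltW.
    by near: y; exact: lt_nbhsr.
  by near: y; exact: lt_nbhsl.
have [h1 h2] := near_eq_derive1 ux.
split.
  apply: h1; have := derivableD d (@derivable_cst _ _ _ (u a) x 1); exact.
rewrite -h2 -dE !derive1E.
have := deriveD d (@derivable_cst _ _ _ (u a) x 1).
by rewrite derive_cst addr0.
Unshelve. all: by end_near. Qed.

Lemma locally_ac_continuous u x : locally_abs_continuous u -> 0 < x -> {for x, continuous u}.
Proof.
move=> lac x0.
have ab : x / 2 <= x + 1 by lra.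
have a0 : 0 < x / 2 by lra.
have /ac_seq_continuous cv := abs_continuous_on_ac_seq ab (lac _ _ a0 ab).
have uv : \forall y \near x, (u \o clip (x / 2) (x + 1)) y = u y.
  near=> y; rewrite /= clip_id//; apply/andP; split; apply: ltW.
    by near: y; apply: lt_nbhsr; lra.
  by near: y; apply: lt_nbhsl; lra.
have := cv x; rewrite /continuous_at (nbhs_singleton uv).
apply: cvg_trans; exact: near_eq_cvg.
Unshelve. all: by end_near. Qed.

(** On the open interval from [1 / (n + 1)] to infinity the derivative only
    depends on [u] composed with the maximum with [1 / (n + 1)], which is
    continuous on the whole line. *)
Lemma measurable_derive1_Rplus u : locally_abs_continuous u ->
  measurable_fun Rplus u^`().
Proof.
move=> lac.
have -> : Rplus = \bigcup_n `]n.+1%:R^-1, +oo[%classic :> set R.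
  apply/seteqP; split => [x|x [n _]]; rewrite /Rplus/= !in_itv/= !andbT.
    by move=> /invSn_lt[n nx]; exists n => //; rewrite /= in_itv/= nx.
  by apply: lt_trans; rewrite invr_gt0.
apply/measurable_fun_bigcup => [n|n]; first exact: measurable_itv.
set a : R := n.+1%:R^-1; have a0 : 0 < a by rewrite invr_gt0.
have cv : continuous (u \o Num.max a).
  move=> x; apply: continuous_comp.
    by apply: continuous_max; [exact: cvg_cst|exact: cvg_id].
  by apply: locally_ac_continuous => //; rewrite lt_max a0.
apply: (@eq_measurable_fun _ _ _ _ _ (u \o Num.max a)^`()); last first.
  by apply: measurable_funTS; exact: measurable_derive1.
move=> x; rewrite inE/= in_itv/= andbT => ax.
have ux : \forall y \near x, (u \o Num.max a) y = u y.
  near=> y; rewrite /= max_r//; apply: ltW.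
  by near: y; apply: lt_nbhsr.
by have [_ ->] := near_eq_derive1 ux.
Unshelve. all: by end_near. Qed.

Lemma locally_ac_ftc u a b : locally_abs_continuous u -> 0 < a -> a <= b ->
  mu.-integrable `]a, b] (EFin \o u^`()) /\
  u b - u a = \int[mu]_(t in `]a, b]) derive1 u t.
Proof.
move=> lac a0; rewrite le_eqVlt => /orP[/eqP <-|ab].
  rewrite set_itvoc0; split; first exact: integrable_set0.
  by rewrite Rintegral_set0 subrr.
have [f [fint fE aeE]] := ac_ftc_density ab (lac _ _ a0 (ltW ab)).
have mab : measurable (`]a, b]%classic : set (measurableTypeR R)) by exact: measurable_itv.
have mu' : measurable_fun `]a, b] u^`().
  apply: measurable_funS (measurable_derive1_Rplus lac); first exact: measurable_itv.
  by apply: subset_itv; rewrite bnd_simp// ltW.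
have fi : mu.-integrable `]a, b] (EFin \o f) by apply: integrableS fint.
have ae : ae_eq mu `]a, b] (EFin \o f) (EFin \o u^`()).
  have nb : {ae mu, forall x, x != b}.
    exists [set b]; split => //; first exact: lebesgue_measure_set1.
    by move=> x /= /negP; rewrite negbK => /eqP.
  apply: (@filterS2 _ _ (ae_filter_ringOfSetsType mu) _ _ _ _ aeE nb) => x H xb /=;
    rewrite in_itv/= => /andP[ax xb'].
  by have [|_ ->] := H; rewrite // ax lt_neqAle xb.
split.
  have mu'E : measurable_fun `]a, b] (EFin \o u^`()) by exact/measurable_EFinP.
  have /integrableP[mf fi'] := fi.
  apply/integrableP; split => //; apply: le_lt_trans fi'; rewrite le_eqVlt.
  apply/orP; left; apply/eqP; apply: ae_eq_integral => //.
  - exact: measurableT_comp.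
  - exact: measurableT_comp.
  - by apply: (@filterS _ _ (ae_filter_ringOfSetsType mu) _ _ _ ae) => x /= H /H [->].
have abb : a <= b <= b by rewrite lexx ltW.
rewrite (fE _ abb) /Rintegral; congr fine.
by apply: ae_eq_integral => //; [case/integrableP: fi|exact/measurable_EFinP].
Qed.

End ftc_ac.

(** * Smooth steps *)

Section smooth_step.
Context {R : realType}.
Implicit Types (f g : R -> R) (a b x y : R).

Definition smooth f := forall n x, derivable f^`(n) x 1.

Lemma smooth_primitive F g : (forall x, is_derive x 1 F (g x)) -> smooth g -> smooth F.
Proof.
move=> dF sg [|n] x; first by have [] := dF x.
rewrite derive1Sn (_ : F^`() = g); first exact: sg.
by apply/funext => y; rewrite derive1E; have [] := dF y.
Qed.

(** The factor [x ^ -k] makes the family closed under differentiation up to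
    linear combinations, see [is_derive_flat]. *)
Definition flat k x : R := if 0 < x then x^-1 ^+ k * expR (- x^-1) else 0.

Lemma flat_ge0 k x : 0 <= flat k x.
Proof.
rewrite /flat; case: ifP => // x0.
by rewrite mulr_ge0 ?expR_ge0// exprn_ge0// invr_ge0 ltW.
Qed.

Lemma flat_le0 k x : x <= 0 -> flat k x = 0.
Proof. by rewrite /flat leNgt => /negbTE ->. Qed.

Lemma flat_gt0 k x : 0 < x -> 0 < flat k x.
Proof. by move=> x0; rewrite /flat x0 mulr_gt0 ?expR_gt0// exprn_gt0// invr_gt0. Qed.

(** From [exp (1 / x) >= (1 / (n x)) ^ n] with [n = k + 1]. This gives
    differentiability at [0], since the difference quotient of [flat k] there
    is [flat (k + 1)]. *)
Lemma flat_linear_bound k x : flat k x <= (k.+1%:R ^+ k.+1) * `|x|.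
Proof.
rewrite /flat; case: ifPn => x0; last by rewrite mulr_ge0// exprn_ge0.
have n0 : (0 : R) < k.+1%:R by [].
rewrite gtr0_norm//; set n : R := k.+1%:R in n0 *.
have h : (n * x) ^- k.+1 <= expR x^-1.
  have -> : x^-1 = (n * x)^-1 * n.
    by rewrite invfM mulrAC mulVf ?mul1r// gt_eqF.
  rewrite expRM_natr -exprVn; apply: lerXn2r; rewrite ?nnegrE ?expR_ge0//.
    by rewrite invr_ge0 mulr_ge0// ltW.
  by apply: le_trans (expR_ge1Dx _); rewrite lerDr.
have nx : 0 < (n * x) ^+ k.+1 by rewrite exprn_gt0// mulr_gt0.
have h' : expR (- x^-1) <= (n * x) ^+ k.+1.
  by rewrite expRN -[leRHS]invrK lef_pV2 ?posrE ?expR_gt0// invr_gt0.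
apply: (@le_trans _ _ (x^-1 ^+ k * (n * x) ^+ k.+1)).
  by rewrite ler_wpM2l// exprn_ge0// invr_ge0 ltW.
rewrite exprMn [x ^+ k.+1]exprSr mulrCA [x^-1 ^+ k * _]mulrA exprVn.
by rewrite mulVf ?mul1r// expf_neq0// gt_eqF.
Qed.

Lemma is_derive_flat k x :
  is_derive x 1 (flat k) (flat k.+2 x - k%:R * flat k.+1 x).
Proof.
have [x0|x0|x0] := ltgtP x 0.
- rewrite !flat_le0 ?ltW// mulr0 subr0.
  have E : \forall y \near x, (cst 0 : R -> R) y = flat k y.
    near=> y; rewrite flat_le0// ltW//; near: y; exact: lt_nbhsl.
  split; first by apply: near_eq_derivable E _.
  by rewrite -(near_eq_derive _ E) // derive_cst.
- have E : \forall y \near x, (fun y => y^-1 ^+ k * expR (- y^-1)) y = flat k y.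
    near=> y; rewrite /flat ifT//; near: y; exact: lt_nbhsr.
  have xn0 : x != 0 by rewrite gt_eqF.
  have D : is_derive x 1 (fun y : R => y^-1 ^+ k * expR (- y^-1)) (flat k.+2 x - k%:R *
    flat k.+1 x).
    have dV : is_derive x 1 (fun y : R => y^-1) (- x ^- 2 *: 1).
      exact: (@is_deriveV _ (fun y => y)).
    have dX := is_deriveX k dV.
    have dN := is_deriveN dV.
    have dE := @is_derive1_comp _ expR (- (fun y : R => y^-1)) x _ _ (is_derive_expR _) dN.
    have dM := is_deriveM dX dE.
    rewrite (_ : (fun y => _) = (fun y : R => y^-1) ^+ k * (expR \o (- (fun y : R =>
      y^-1)))); last first.
      by apply/funext => y; rewrite -[RHS]/(((fun y : R => y^-1) ^+ k) y * expR (- y^-1))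
        exprfctE.
    apply: is_derive_eq dM _.
    rewrite /flat x0 exprfctE /GRing.scale/= -!exprVn !exprS.
    rewrite -[(- _) x]/(- x^-1).
    move: (expR _) => e; case: (k) => [|j]; first by rewrite /= expr0; ring.
    by rewrite /= exprS; ring.
  split; first by apply: near_eq_derivable E _; case: D.
  by rewrite -(near_eq_derive _ E) //; case: D.
- rewrite x0 !flat_le0// mulr0 subr0.
  have N0 : `|h| @[h --> (0 : R)^'] --> (0 : R).
    by apply: cvg_within_filter; have := @norm_continuous _ R 0; rewrite /continuous_at normr0.
  have cv : h^-1 *: (flat k (h *: 1 + 0) - flat k 0) @[h --> 0^'] --> (0 : R).
    apply: (@squeeze_cvgr _ _ _ _ (fun h => - ((k.+2%:R ^+ k.+2) * `|h|)) (fun h =>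
      (k.+2%:R ^+ k.+2) * `|h|)).
    + rewrite near_withinE; apply: nearW => h h0.
      rewrite [h *: 1]mulr1 addr0 (@flat_le0 k 0)// subr0 /GRing.scale/= -ler_norml normrM.
      have [hp|hn] := ltP 0 h; last first.
        by rewrite (flat_le0 _ hn) normr0 mulr0 mulr_ge0// exprn_ge0.
      apply: le_trans (flat_linear_bound _ _).
      by rewrite !ger0_norm ?flat_ge0 ?invr_ge0 ?(ltW hp)// /flat hp exprS mulrA.
    + rewrite -[X in _ --> X]oppr0; apply: cvgN;
      rewrite -[X in _ --> X](mulr0 (k.+2%:R ^+ k.+2)).
      apply: cvgM; first exact: cvg_cst.
      exact: N0.
    + rewrite -[X in _ --> X](mulr0 (k.+2%:R ^+ k.+2)).
      apply: cvgM; first exact: cvg_cst.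
      exact: N0.
  split; first by apply/cvg_ex; exists 0.
  by apply/cvg_lim.
Unshelve. all: by end_near. Qed.

(** A class of functions stable under differentiation, so that its members are
    smooth: no formula for higher derivatives is needed. *)
Inductive elementary : (R -> R) -> Prop :=
| elem_flat k a b : elementary (fun x => flat k (a * x + b))
| elem_cst c : elementary (cst c)
| elem_add f g : elementary f -> elementary g -> elementary (f \+ g)
| elem_mul f g : elementary f -> elementary g -> elementary (f \* g)
| elem_inv f : elementary f -> (forall x, f x != 0) ->
    elementary (fun x => (f x)^-1).

Lemma elementary_derive f : elementary f ->
  exists2 g, elementary g & forall x, is_derive x 1 f (g x).
Proof.
elim=> {f} [k a b|c|f g ef [f' ef' df] eg [g' eg' dg]|
    f g ef [f' ef' df] eg [g' eg' dg]|f ef [f' ef' df] f0].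
- exists (fun x => (flat k.+2 (a * x + b) + (cst (- k%:R) \* (fun x => flat k.+1 (a * x +
  b))) x) * cst a x).
    by apply: (@elem_mul (fun x => _)); [apply: (@elem_add (fun x => _));
      [exact: elem_flat|apply: elem_mul; [exact: elem_cst|exact: elem_flat]]|exact: elem_cst].
  move=> x; have da : is_derive x 1 (fun x : R => a * x + b) a.
    by apply: is_derive_eq; rewrite /GRing.scale/=; ring.
  have := @is_derive1_comp _ (flat k) (fun x => a * x + b) x _ _ (is_derive_flat _ _) da.
  by rewrite /= mulNr.
- by exists (cst 0); [exact: elem_cst|move=> x; exact: is_derive_cst].
- exists (f' \+ g'); [exact: elem_add|move=> x].
  exact: is_deriveD.
- exists ((f \* g') \+ (g \* f')).
    by apply: elem_add; exact: elem_mul.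
  move=> x; exact: is_deriveM.
- exists (fun x => cst (-1) x * ((f x)^-1 * (f x)^-1 * f' x)).
    apply: (@elem_mul (cst _) (fun x => _)); first exact: elem_cst.
    apply: (@elem_mul (fun x => _)) => //; apply: (@elem_mul (fun x => _) (fun x => _));
      exact: elem_inv.
  move=> x; have := @is_deriveV _ _ x _ _ (f0 x) (df x).
  by rewrite /GRing.scale/= expr2 invfM mulN1r mulNr.
Qed.

Lemma elementary_smooth f : elementary f -> smooth f.
Proof.
move=> ef n; elim: n f ef => [|n IH] f ef x.
  by have [g _ /(_ x)[]] := elementary_derive ef.
have [g eg dg] := elementary_derive ef.
rewrite derive1Sn (_ : f^`() = g); first exact: IH.
by apply/funext => y; rewrite derive1E; have [] := dg y.
Qed.

Lemma smooth_continuous f : smooth f -> continuous f.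
Proof. by move=> sf x; apply: differentiable_continuous; apply/derivable1_diffP;
  exact: (sf 0). Qed.

(** The denominator never vanishes because [x] and [1 - x] are not both
    nonpositive. *)
Definition step x := flat 0 x / (flat 0 x + flat 0 (1 - x)).

Lemma step_denom_gt0 x : 0 < flat 0 x + flat 0 (1 - x).
Proof.
have [x0|x0] := ltP 0 x.
  by rewrite ltr_pwDl ?flat_gt0 ?flat_ge0.
by rewrite ltr_wpDl ?flat_ge0// flat_gt0//; lra.
Qed.

Lemma step_ge0 x : 0 <= step x.
Proof. by rewrite /step divr_ge0 ?flat_ge0// ltW ?step_denom_gt0. Qed.

Lemma step_le1 x : step x <= 1.
Proof. by rewrite /step ler_pdivrMr ?step_denom_gt0// mul1r lerDl flat_ge0. Qed.

Lemma step_le0 x : x <= 0 -> step x = 0.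
Proof. by move=> x0; rewrite /step flat_le0// mul0r. Qed.

Lemma step_ge1 x : 1 <= x -> step x = 1.
Proof.
move=> x1; rewrite /step (@flat_le0 _ (1 - x)) ?subr_le0// addr0 divff//.
by rewrite gt_eqF// flat_gt0// (lt_le_trans _ x1).
Qed.

Lemma elementary_step a b : elementary (fun x => step (a * x + b)).
Proof.
apply: (@elem_mul (fun x => _) (fun x => _)); first exact: elem_flat.
apply: (@elem_inv (fun x => _)); last by move=> x; rewrite gt_eqF// step_denom_gt0.
apply: (@elem_add (fun x => _) (fun x => _)); first exact: elem_flat.
rewrite (_ : (fun x => _) = (fun x => flat 0 ((- a) * x + (1 - b)))); first exact: elem_flat.
by apply/funext => x; congr flat; ring.
Qed.

End smooth_step.

(** * The energy of a function *)

Section energy.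
Context {R : realType}.
Local Notation mu := (@lebesgue_measure R).
Variables (p : R) (w : R -> R).
Hypothesis p_gt1 : 1 < p.
Hypothesis w_gt0 : forall t : R, 0 < t -> 0 < w t.
Hypothesis w_cont : {within Rplus, continuous w}.
Implicit Types (f g h : R -> R) (a b c d x y : R).

Let p0 : 0 < p. Proof. exact: lt_trans p_gt1. Qed.
Let pge0 : 0 <= p. Proof. exact: ltW. Qed.
Let pneq0 : p != 0. Proof. by rewrite gt_eqF. Qed.

Lemma RplusE x : Rplus x = (0 < x) :> Prop.
Proof. by rewrite /Rplus/= in_itv/= andbT. Qed.

Lemma measurable_Rplus : measurable (Rplus : set (measurableTypeR R)).
Proof. exact: measurable_itv. Qed.
Hint Resolve measurable_Rplus : core.

Lemma measurable_weight : measurable_fun Rplus w.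
Proof. exact: subspace_continuous_measurable_fun. Qed.

Definition weighted_energy f : \bar R := (\int[mu]_(t in Rplus) (`|f t| `^ p * w t)%:E)%E.

Local Notation energy := weighted_energy.

Lemma wLnormE f : wLnorm p w f = (energy f `^ p^-1)%E.
Proof. by []. Qed.

Let efun_ge0 f x : Rplus x -> (0 <= (`|f x| `^ p * w x)%:E)%E.
Proof. by rewrite RplusE => x0; rewrite lee_fin mulr_ge0 ?powR_ge0// ltW// w_gt0. Qed.

Lemma energy_ge0 f : (0 <= energy f)%E.
Proof. by apply: integral_ge0 => x; exact: efun_ge0. Qed.

Lemma wLnorm_lty f : (wLnorm p w f < +oo)%E <-> (energy f < +oo)%E.
Proof.
rewrite wLnormE; split => h; last exact: poweR_lty.
have : ((energy f `^ p^-1) `^ p < +oo)%E by exact: poweR_lty.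
by rewrite -poweRrM mulVf// poweRe1// energy_ge0.
Qed.

Lemma measurable_energy f : measurable_fun Rplus f ->
  measurable_fun Rplus (fun t => (`|f t| `^ p * w t)%:E).
Proof.
move=> mf; apply/measurable_EFinP; apply: measurable_funM; last exact: measurable_weight.
apply: (measurableT_comp (measurable_powR _)).
exact: measurableT_comp.
Qed.

Lemma energy_le f g : measurable_fun Rplus f -> measurable_fun Rplus g ->
  (forall x, 0 < x -> `|f x| <= `|g x|) -> (energy f <= energy g)%E.
Proof.
move=> mf mg fg; apply: ge0_le_integral => //.
- by move=> x; exact: efun_ge0.
- exact: measurable_energy.
- exact: measurable_energy.
move=> x; rewrite RplusE => x0; rewrite lee_fin ler_wpM2r//.
  by rewrite ltW// w_gt0.
by apply: ge0_ler_powR; rewrite ?nnegrE// fg.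
Qed.

Lemma powRD_le (a b : R) : 0 <= a -> 0 <= b -> (a + b) `^ p <= 2 `^ p * (a `^ p + b `^ p).
Proof.
move=> a0 b0.
have ab : a + b <= 2 * Num.max a b.
  have h1 : a <= Num.max a b by rewrite le_max lexx.
  have h2 : b <= Num.max a b by rewrite le_max lexx orbT.
  lra.
have m0 : 0 <= Num.max a b by rewrite le_max a0.
apply: (@le_trans _ _ ((2 * Num.max a b) `^ p)).
  by apply: ge0_ler_powR; rewrite ?nnegrE// ?addr_ge0// mulr_ge0.
rewrite powRM// ler_wpM2l ?powR_ge0//.
by rewrite /Num.max; case: ifP => _; rewrite ?lerDr ?lerDl powR_ge0.
Qed.

Lemma energyD f g : measurable_fun Rplus f -> measurable_fun Rplus g ->
  (energy (f \+ g)%R <= (2 `^ p)%:E * (energy f + energy g))%E.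
Proof.
move=> mf mg; have mF := measurable_energy mf; have mG := measurable_energy mg.
have -> : (energy f + energy g)%E =
    (\int[mu]_(t in Rplus) ((`|f t| `^ p * w t)%:E + (`|g t| `^ p * w t)%:E))%E.
  by rewrite ge0_integralD//; exact: efun_ge0.
rewrite -ge0_integralZl//; [|exact: emeasurable_funD
  |by move=> x Rx; rewrite adde_ge0// efun_ge0].
apply: ge0_le_integral => //.
- exact: efun_ge0.
- by apply: measurable_energy; exact: measurable_funD.
- by apply: measurable_funeM; exact: emeasurable_funD.
move=> x; rewrite RplusE => x0; rewrite -EFinD -EFinM lee_fin -mulrDl mulrA.
rewrite ler_wpM2r//; first by rewrite ltW// w_gt0.
apply: le_trans (powRD_le _ _) => //.
apply: ge0_ler_powR; rewrite ?nnegrE ?addr_ge0//; exact: ler_normD.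
Qed.

Lemma energyN f : energy (\- f) = energy f.
Proof. by apply: eq_integral => x _; rewrite normrN. Qed.

Lemma energyB_sym f g : energy (f \- g) = energy (g \- f).
Proof. by apply: eq_integral => x _ /=; rewrite distrC. Qed.

Lemma energy_scale (k : R) f : measurable_fun Rplus f -> energy (fun x => k * f x) =
  ((`|k| `^ p)%:E * energy f)%E.
Proof.
move=> mf; rewrite /weighted_energy -ge0_integralZl//.
- by apply: eq_integral => x _; rewrite -EFinM mulrA normrM powRM.
- exact: measurable_energy.
- exact: efun_ge0.
Qed.

Lemma powR_cvg_to0 (u_ : nat -> R) : u_ n @[n --> \oo] --> (0 : R) ->
  `|u_ n| `^ p @[n --> \oo] --> (0 : R).
Proof.
move=> u0; apply/cvgrPdist_lt => e e0.
have m0 : 0 < Num.min 1 e by rewrite lt_min ltr01.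
move/cvgrPdist_lt : u0 => /(_ _ m0) [N _ H]; exists N => // n /= /H.
rewrite !sub0r !normrN lt_min => /andP[u1 ue].
rewrite ger0_norm ?powR_ge0//.
have [->|un0] := eqVneq (u_ n) 0; first by rewrite normr0 powR0.
by apply: le_lt_trans ue; apply: ge1r_powR; rewrite ?normr_gt0 ?un0 ltW.
Qed.

Lemma energy_dominated (f_ : nat -> R -> R) h :
  (forall n, measurable_fun Rplus (f_ n)) -> measurable_fun Rplus h ->
  (energy h < +oo)%E ->
  (forall n x, 0 < x -> `|f_ n x| <= `|h x|) ->
  (forall x, 0 < x -> f_ n x @[n --> \oo] --> (0 : R)) ->
  energy (f_ n) @[n --> \oo] --> 0%E.
Proof.
move=> mf mh hfin fh f0.
have -> : 0%E = (\int[mu]_(t in Rplus) (cst 0 t))%E by rewrite integral0.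
apply: (@dominated_cvg _ _ _ mu Rplus measurable_Rplus
  (fun n t => (`|f_ n t| `^ p * w t)%:E) (cst 0%E) (fun t => (`|h t| `^ p * w t)%:E)) => //.
- by move=> n; exact: measurable_energy.
- move=> x; rewrite RplusE => x0; apply/fine_cvgP; split; first exact: nearW.
  rewrite /comp/= -[X in _ --> X](mul0r (w x)); apply: cvgM; last exact: cvg_cst.
  exact/powR_cvg_to0/f0.
- apply/integrableP; split; first exact: measurable_energy.
  apply: le_lt_trans hfin; rewrite le_eqVlt; apply/orP; left; apply/eqP.
  by apply: eq_integral => x; rewrite inE => Rx; rewrite gee0_abs// efun_ge0.
- move=> n x Rx; rewrite gee0_abs ?efun_ge0//; move: Rx; rewrite RplusE => x0.
  rewrite lee_fin ler_wpM2r//; first by rewrite ltW// w_gt0.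
  by apply: ge0_ler_powR; rewrite ?nnegrE// fh.
Qed.
End energy.

(** * Approximation by smooth partitions of unity *)

Section step_approximation.
Context {R : realType}.
Implicit Types (g : R -> R) (c d x y : R).

Lemma elementary_sum n (F : 'I_n -> R -> R) : (forall i, elementary (F i)) ->
  elementary (fun x => \sum_(i < n) F i x).
Proof.
elim: n F => [|n IH] F eF.
  rewrite (_ : (fun x => _) = cst 0); first exact: elem_cst.
  by apply/funext => x; rewrite big_ord0.
rewrite (_ : (fun x => _) = (fun x => \sum_(i < n) F (widen_ord (leqnSn n) i) x) \+ F ord_max).
  by apply: elem_add => //; exact: IH.
by apply/funext => x; rewrite big_ord_recr.
Qed.

Definition bump y : R := step y - step (y - 1).

Lemma bump_ge0 y : 0 <= bump y.
Proof.
rewrite /bump; have [y1|y1] := leP y 1.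
  by rewrite (@step_le0 _ (y - 1)) ?subr0 ?step_ge0// subr_le0.
by rewrite (@step_ge1 _ y) ?subr_ge0 ?step_le1// ltW.
Qed.

Lemma bump_eq0 y : y <= 0 \/ 2 <= y -> bump y = 0.
Proof.
case=> hy; rewrite /bump; first by rewrite !step_le0 ?subrr//; lra.
by rewrite !step_ge1 ?subrr//; lra.
Qed.

Lemma sum_bump n y : \sum_(i < n) bump (y - i%:R) = step y - step (y - n%:R).
Proof.
elim: n => [|n IH]; first by rewrite big_ord0 subr0 subrr.
rewrite big_ord_recr/= IH /bump.
rewrite (_ : y - n%:R - 1 = y - n.+1%:R); first by ring.
by rewrite -natr1; ring.
Qed.

(** With mesh [delta = (d - c) / (n + 1)], this is the sum of the values of
    [g] at the mesh points weighted by the partition of unity formed by the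
    translates of [bump]. *)
Definition step_approx g c d n x :=
  let delta := (d - c) / n.+1%:R in
  \sum_(i < n.+1) g (c + i%:R * delta) * bump ((x - c) / delta - i%:R).

Lemma elementary_step_approx g c d n : elementary (step_approx g c d n).
Proof.
apply: elementary_sum => i; apply: (@elem_mul _ (cst _) (fun x => _)); first exact: elem_cst.
set D := _ / _.
rewrite (_ : (fun x => _) = (fun x => step (D^-1 * x + (- c * D^-1 - i%:R))) \+
   (cst (-1) \* (fun x => step (D^-1 * x + (- c * D^-1 - i%:R - 1))))).
  apply: elem_add; first exact: elementary_step.
  by apply: elem_mul; [exact: elem_cst|exact: elementary_step].
apply/funext => x; rewrite /bump/= mulN1r; congr (step _ - step _); ring.
Qed.

Section facts.
Variables (g : R -> R) (c d N : R).
Hypothesis cd : c < d.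
Hypothesis gN : forall x, `|g x| <= N.
Let N0 : 0 <= N. Proof. by apply: le_trans (gN 0). Qed.
Let D0 n : 0 < (d - c) / n.+1%:R. Proof. by rewrite divr_gt0 ?subr_gt0. Qed.

Lemma step_approx_le n x : `|step_approx g c d n x| <= N.
Proof.
apply: le_trans (ler_norm_sum _ _ _) _.
apply: (@le_trans _ _ (\sum_(i < n.+1) N * bump ((x - c) / ((d - c) / n.+1%:R) - i%:R))).
  apply: ler_sum => i _; rewrite normrM [X in _ * X]ger0_norm ?bump_ge0//.
  by rewrite ler_wpM2r ?bump_ge0.
rewrite -mulr_sumr sum_bump ler_piMr//.
by rewrite lerBlDr (le_trans (step_le1 _))// lerDl step_ge0.
Qed.

Lemma step_approx_left n x : x <= c -> step_approx g c d n x = 0.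
Proof.
move=> xc; rewrite /step_approx big1// => i _; rewrite bump_eq0 ?mulr0//; left.
rewrite lerBlDr add0r (@le_trans _ _ 0)//.
by rewrite pmulr_lle0 ?invr_gt0// subr_le0.
Qed.

Lemma step_approx_right n x : d + (d - c) / n.+1%:R <= x -> step_approx g c d n x = 0.
Proof.
move=> xd; rewrite /step_approx big1// => i _; rewrite bump_eq0 ?mulr0//; right.
have Dn := D0 n; move: Dn xd; set D := (d - c) / _ => Dn xd.
have dE : d = c + n.+1%:R * D by rewrite /D mulrC divfK ?pnatr_eq0//; ring.
have iN : i%:R <= n%:R :> R by rewrite ler_nat -ltnS.
rewrite lerBrDr ler_pdivlMr//.
have : (2 + i%:R) * D <= (2 + n%:R) * D by rewrite ler_wpM2r ?lerD2l// ltW.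
move=> h; apply: le_trans h _; move: xd; rewrite dE -natr1.
by rewrite !mulrDl; lra.
Qed.

Lemma step_approx0 n x : x <= c \/ d + (d - c) <= x -> step_approx g c d n x = 0.
Proof.
case=> [xc|dx]; first exact: step_approx_left.
apply: step_approx_right; apply: le_trans dx.
by rewrite lerD2l ler_pdivrMr// ler_peMr ?ler1n// ltW// subr_gt0.
Qed.

(** Near an interior point the bumps add up to [1], and those which do not
    vanish there sit at mesh points within [2 delta]. At [c] all bumps vanish,
    whence the half-open interval. *)
Lemma step_approx_cvg x : continuous g ->
  step_approx g c d n x @[n --> \oo] --> (g \_ `]c, d]) x.
Proof.
move=> cg; rewrite patchE; case: ifPn; rewrite ?inE ?notin_setE/= in_itv/=; last first.
  move=> /negP; rewrite negb_and -!leNgt -ltNge => /orP[xc|dx].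
    by under eq_fun do rewrite step_approx_left//; exact: cvg_cst.
  apply: (@cvg_near_cst _ _ _ _ _).
  have [m hm] : exists m : nat, m.+1%:R^-1 < (x - d) / (d - c).
    by apply: invSn_lt; rewrite divr_gt0 ?subr_gt0.
  exists m => // n /= mn; apply: step_approx_right.
  have : n.+1%:R^-1 <= m.+1%:R^-1 :> R by rewrite lef_pV2 ?posrE// ler_nat.
  by move=> /le_lt_trans /(_ hm); rewrite ltr_pdivlMr ?subr_gt0// mulrC => /ltW;
    rewrite lerBrDl.
move=> /andP[cx xd]; apply/cvgrPdist_le => e e0.
have /cvgrPdist_lt /(_ _ e0) [/= eta eta0 H] := cg x.
have [m hm] : exists m : nat, m.+1%:R^-1 < Num.min (x - c) (eta / 2) / (d - c).
  by apply: invSn_lt; rewrite divr_gt0 ?lt_min ?subr_gt0// cx divr_gt0.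
exists m => // n /= mn.
have : n.+1%:R^-1 <= m.+1%:R^-1 :> R by rewrite lef_pV2 ?posrE// ler_nat.
move=> /le_lt_trans /(_ hm); rewrite ltr_pdivlMr ?subr_gt0// mulrC lt_min.
have Dn := D0 n; have dE : d = c + n.+1%:R * ((d - c) / n.+1%:R).
  by rewrite mulrC divfK ?pnatr_eq0//; ring.
rewrite /step_approx; move: dE Dn; set D := (d - c) / n.+1%:R => dE Dn /andP[Dx De].
set y := (x - c) / D.
have S1 : \sum_(i < n.+1) bump (y - i%:R) = 1.
  rewrite sum_bump (@step_ge1 _ y) ?(@step_le0 _ (y - n.+1%:R)) ?subr0//.
    by rewrite subr_le0 ler_pdivrMr// lerBlDl -dE.
  by rewrite ler_pdivlMr// mul1r ltW.
have -> : g x = \sum_(i < n.+1) g x * bump (y - i%:R) by rewrite -mulr_sumr S1 mulr1.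
rewrite -sumrB; apply: le_trans (ler_norm_sum _ _ _) _.
have -> : e = \sum_(i < n.+1) e * bump (y - i%:R) by rewrite -mulr_sumr S1 mulr1.
apply: ler_sum => i _.
rewrite -mulrBl normrM [X in _ * X]ger0_norm ?bump_ge0//.
have [yi|yi] := boolP ((y - i%:R <= 0) || (2 <= y - i%:R)).
  by rewrite bump_eq0 ?mulr0//; apply/orP.
rewrite ler_wpM2r ?bump_ge0//; apply/ltW/H => /=.
have xE : x - (c + i%:R * D) = (y - i%:R) * D.
  by rewrite mulrBl /y divfK ?gt_eqF//; ring.
rewrite xE normrM; move: yi; rewrite negb_or -!ltNge => /andP[y0 y2].
rewrite !gtr0_norm//; apply: (@lt_trans _ _ (2 * D)); first by rewrite ltr_pM2r.
lra.
Qed.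

End facts.
End step_approximation.

(** * Density of smooth functions in energy *)

Section smoothing.
Context {R : realType}.
Local Notation mu := (@lebesgue_measure R).
Variables (p : R) (w : R -> R).
Hypothesis p_gt1 : 1 < p.
Hypothesis w_gt0 : forall t : R, 0 < t -> 0 < w t.
Hypothesis w_cont : {within Rplus, continuous w}.
Implicit Types (f g h : R -> R) (a b c d x y : R).
Local Notation energy := (weighted_energy p w).
Let mR := @measurable_Rplus R.
Hint Resolve mR : core.

Lemma itv_Rplus a b : 0 <= a -> `]a, b] `<=` Rplus.
Proof.
by move=> a0 x /=; rewrite RplusE in_itv/= => /andP[+ _]; exact: le_lt_trans.
Qed.

Lemma weight_bounded c d : 0 < c -> exists2 M : R, 0 < M &
  forall x, c <= x <= d -> w x <= M /\ M^-1 <= w x.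
Proof.
move=> c0; have [cd|dc] := leP c d; last first.
  by exists 1 => // x /andP[cx xd]; have := le_trans cx xd; rewrite leNgt dc.
have wc : {within `[c, d], continuous w}.
  apply: continuous_subspaceW w_cont => x /=; rewrite in_itv/= RplusE => /andP[+ _].
  exact: lt_le_trans.
have [xM /[!in_itv]/= /andP[cM _] HM] := EVT_max cd wc.
have [xm /[!in_itv]/= /andP[cm _] Hm] := EVT_min cd wc.
have wM0 : 0 < w xM by rewrite w_gt0// (lt_le_trans c0).
have wm0 : 0 < w xm by rewrite w_gt0// (lt_le_trans c0).
exists (w xM + (w xm)^-1); first by rewrite addr_gt0 ?invr_gt0.
move=> x xcd; split.
  by rewrite (le_trans (HM x _)) ?in_itv// lerDl invr_ge0 ltW.
apply: (@le_trans _ _ (w xm)); last by apply: Hm; rewrite in_itv.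
by rewrite -[leRHS]invrK lef_pV2 ?posrE ?invr_gt0 ?addr_gt0 ?invr_gt0// lerDr ltW.
Qed.

Lemma cvg0_exists_lt (u_ : nat -> \bar R) (e : R) : 0 < e ->
  u_ n @[n --> \oo] --> 0%E -> exists n, (u_ n < e%:E)%E.
Proof.
move=> e0 /fine_cvgP[[N1 _ h1] /cvgrPdist_lt /(_ _ e0) [N2 _ h2]].
exists (maxn N1 N2).
rewrite -(fineK (h1 _ _)) /= ?leq_maxl// lte_fin.
have := h2 (maxn N1 N2); rewrite /= leq_maxr sub0r normrN => /(_ isT).
exact: le_lt_trans (ler_norm _).
Qed.

(** Since [|f|^p <= B^(p-1) |f|], approximation in mean of bounded functions
    gives approximation in energy. *)
Lemma energy_le_L1 f c d M B : 0 < c -> measurable_fun Rplus f ->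
  (forall x, c <= x <= d -> w x <= M) -> 0 <= M -> 0 <= B ->
  (forall x, 0 < x -> `|f x| <= B) ->
  (forall x, x <= c \/ d < x -> f x = 0) ->
  (energy f <= (B `^ (p - 1) * M)%:E * \int[mu]_(x in `]c, d]) `|f x|%:E)%E.
Proof.
move=> c0 mf wM M0 B0 fB f0.
have mcd : measurable (`]c, d]%classic : set (measurableTypeR R)) by exact: measurable_itv.
have sub := @itv_Rplus c d (ltW c0).
have mnf : measurable_fun Rplus (fun x => `|f x|%:E) by apply/measurable_EFinP;
  exact: measurableT_comp.
have mnf' : measurable_fun `]c, d] (fun x => `|f x|%:E) by apply: measurable_funS mnf.
have -> : energy f = (\int[mu]_(t in `]c, d]) (`|f t| `^ p * w t)%:E)%E.
  rewrite /weighted_energy [RHS](integral_mkcond) [LHS]integral_mkcond.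
  apply: eq_integral => x _; rewrite !patchE.
  case: ifPn => [xR|xR]; case: ifPn => // xcd.
  - rewrite f0 ?normr0 ?powR0 ?mul0r ?gt_eqF//; first exact: lt_trans p_gt1.
    by move: xcd; rewrite notin_setE/= in_itv/= => /negP;
      rewrite negb_and -leNgt -ltNge => /orP.
  - by move: xR; rewrite notin_setE; case; apply: sub; exact: set_mem.
rewrite -ge0_integralZl//; last by rewrite lee_fin mulr_ge0 ?powR_ge0.
apply: ge0_le_integral => //.
- by move=> x /sub; rewrite RplusE => x0; rewrite lee_fin mulr_ge0 ?powR_ge0// ltW// w_gt0.
- exact: measurable_funS mR sub (measurable_energy p w_cont mf).
- exact: measurable_funeM.
move=> x /[dup] /sub; rewrite RplusE => x0 /=; rewrite in_itv/= => /andP[cx xd].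
rewrite -EFinM lee_fin mulrAC.
have -> : `|f x| `^ p = `|f x| * `|f x| `^ (p - 1) by rewrite mulr_powRB1// (lt_trans _ p_gt1).
rewrite [`|f x| * _]mulrC; apply: ler_pM; rewrite ?mulr_ge0 ?powR_ge0//.
- by rewrite ltW// w_gt0.
- rewrite ler_wpM2r//; apply: ge0_ler_powR; rewrite ?nnegrE ?fB//.
  by rewrite subr_ge0 ltW.
- by apply: wM; rewrite xd ltW.
Qed.

Lemma energy_bounded_fin f c d B : 0 < c -> measurable_fun Rplus f ->
  (forall x, 0 < x -> `|f x| <= B) -> (forall x, x <= c \/ d < x -> f x = 0) ->
  (energy f < +oo)%E.
Proof.
move=> c0 mf fB f0; have [M M0 wM] := weight_bounded d c0.
have B0 : 0 <= B by apply: le_trans (fB c c0).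
apply: le_lt_trans (energy_le_L1 c0 mf _ (ltW M0) B0 fB f0) _.
  by move=> x /wM[].
have mcd : measurable (`]c, d]%classic : set (measurableTypeR R)) by exact: measurable_itv.
have sub := @itv_Rplus c d (ltW c0).
apply: (@le_lt_trans _ _ ((B `^ (p - 1) * M)%:E * \int[mu]_(x in `]c, d]) B%:E)%E).
  apply: lee_wpmul2l; first by rewrite lee_fin mulr_ge0 ?powR_ge0// ltW.
  apply: ge0_le_integral => //.
    apply/measurable_EFinP; apply: measurableT_comp => //.
    by apply: measurable_funS mf.
  by move=> x /sub; rewrite RplusE => x0; rewrite lee_fin fB.
rewrite integral_cst//= lebesgue_measure_itv/=.
by case: ifP => _; rewrite ?mule0 ?ltry// -EFinB -!EFinM ltry.
Qed.

(** Three approximations in energy: [h] by a truncation, the truncation by a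
    truncated continuous function, and the latter by [step_approx]. The first
    and the last converge by domination, the second one through
    [energy_le_L1]. *)
Lemma smooth_dense h c d e : 0 < c -> c < d -> 0 < e ->
  measurable_fun Rplus h -> (energy h < +oo)%E ->
  (forall x, x <= c \/ d < x -> h x = 0) ->
  exists psi, [/\ elementary psi,
    forall x, x <= c \/ d + (d - c) <= x -> psi x = 0 &
    (energy (h \- psi)%R <= e%:E)%E].
Proof.
move=> c0 cd e0 mh hfin h0.
have K0 : 0 < 2 `^ p :> R by rewrite powR_gt0.
set K : R := 2 `^ p in K0.
(* Three errors of energy [e1], added by two uses of the quasi-triangle
   inequality with constant [K]. *)
pose e1 := e / (K + K * (K + K)).
have e10 : 0 < e1 by rewrite divr_gt0// addr_gt0// mulr_gt0// addr_gt0.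
have mcd : measurable (`]c, d]%classic : set (measurableTypeR R)) by exact: measurable_itv.
have sub := @itv_Rplus c d (ltW c0).
have clipM (N : nat) : measurable_fun setT (clip (- N%:R) (N%:R : R)).
  by apply: continuous_measurable_fun; exact: continuous_clip.
have clip_le (N : nat) x : `|clip (- N%:R) (N%:R : R) x| <= N%:R.
  by have := @clip_in R (- N%:R) N%:R x; rewrite ler_norml; apply;
    rewrite -subr_ge0 opprK addr_ge0.
pose T (N : nat) x := clip (- N%:R) N%:R (h x).
have mT N : measurable_fun Rplus (T N) by apply: measurableT_comp => //; exact: clipM.
have [N TN] : exists N, (energy (h \- T N)%R < e1%:E)%E.
  apply: cvg0_exists_lt => //.
  apply: (energy_dominated p_gt1 w_gt0 w_cont _ mh hfin).
  - by move=> n; apply: measurable_funB.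
  - by move=> n x x0; apply: clip_error; rewrite ler0n.
  - move=> x x0; apply: cvg_near_cst; exists (Num.bound `|h x|) => // n /= nb.
    have hn : `|h x| <= n%:R.
      by apply/ltW/(lt_le_trans (archi_boundP _)); rewrite ?ler_nat.
    by rewrite /T clip_id ?subrr// -ler_norml.
have T0 x : x <= c \/ d < x -> T N x = 0.
  by move=> /h0 hx; rewrite /T hx clip_id// oppr_le0 !ler0n.
have Tint : mu.-integrable `]c, d] (EFin \o T N).
  apply/integrableP; split.
    by apply/measurable_EFinP; apply: measurable_funS (mT N).
  apply: (@le_lt_trans _ _ (\int[mu]_(x in `]c, d]) N%:R%:E)%E).
    apply: ge0_le_integral => //.
    - by apply: measurableT_comp => //; apply/measurable_EFinP; apply: measurable_funS (mT N).
    - by move=> x _; rewrite lee_fin; exact: clip_le.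
  rewrite integral_cst//= lebesgue_measure_itv/=.
  by case: ifP => _; rewrite ?mule0 ?ltry// -EFinB -!EFinM ltry.
have mufin : (mu `]c, d]%classic < +oo)%E.
  by rewrite lebesgue_measure_itv/= lte_fin cd -EFinB ltry.
have [g_ [cg gint gcv]] := approximation_continuous_integrable mcd mufin Tint.
have [M M0 wM] := weight_bounded d c0.
pose G n x := clip (- N%:R) (N%:R : R) (g_ n x).
have cG n : continuous (G n).
  by move=> x; apply: (@continuous_comp _ _ _ (g_ n)); [exact: cg|exact: continuous_clip].
have mG n : measurable_fun Rplus (G n) by apply: measurable_funTS;
  exact: continuous_measurable_fun.
have GN n x : `|G n x| <= N%:R by exact: clip_le.
have mGr n : measurable_fun Rplus (G n \_ `]c, d]).
  apply: measurable_funTS; apply/(measurable_restrictT _ mcd).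
  by apply: measurable_funTS; exact: continuous_measurable_fun.
pose k : R := (2 * N%:R) `^ (p - 1) * M.
have k0 : 0 <= k by rewrite mulr_ge0 ?powR_ge0// ltW.
have [n Gn] : exists n, (energy (T N \- G n \_ `]c, d])%R < e1%:E)%E.
  have e2 : 0 < e1 / (k + 1) by rewrite divr_gt0// ltr_wpDl.
  have [n hn] := cvg0_exists_lt e2 gcv; exists n.
  apply: (@le_lt_trans _ _ (k%:E * \int[mu]_(x in `]c, d]) `|(T N \- G n \_ `]c, d])%R
    x|%:E)%E).
    apply: energy_le_L1 => //.
    - exact: measurable_funB.
    - by move=> x xcd; have [] := wM x.
    - exact: ltW.
    - move=> x x0; rewrite /= (le_trans (ler_normB _ _))// mulr2n mulrDl mul1r lerD ?clip_le//.
      by rewrite patchE; case: ifP => _; rewrite ?GN ?normr0.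
    - move=> x xcd; rewrite /= T0// patchE ifF ?subr0//; apply/negbTE;
      rewrite notin_setE/= in_itv/=.
      by case: xcd => [xc|dx]; apply/negP; rewrite negb_and -leNgt -ltNge ?xc ?dx ?orbT.
  apply: (@le_lt_trans _ _ (k%:E * (e1 / (k + 1))%:E)%E).
    apply: lee_wpmul2l; first by rewrite lee_fin.
    apply/ltW; apply: le_lt_trans hn.
    apply: ge0_le_integral => //.
    - apply/measurable_EFinP; apply: measurableT_comp => //; apply: measurable_funS mR sub _.
      by apply: measurable_funB; [exact: mT|exact: mGr].
    - apply: measurableT_comp => //; apply/measurable_EFinP; apply: measurable_funB.
        exact: measurable_funS (mT N).
      by apply: measurable_funTS; exact: continuous_measurable_fun.
    - move=> x xcd; rewrite lee_fin /= patchE mem_set//.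
      have := clip_dist (- N%:R) N%:R (T N x) (g_ n x).
      by rewrite (clip_id (x := T N x)) // -ler_norml clip_le.
  by rewrite -EFinM lte_fin mulrCA gtr_pMr// ltr_pdivrMr ?ltr_wpDl// mul1r ltrDl.
have [j Gj] : exists j, (energy (G n \_ `]c, d] \- step_approx (G n) c d j)%R < e1%:E)%E.
  apply: cvg0_exists_lt => //.
  pose B x := (2 * N%:R) * \1_(`]c, (d + (d - c))]%classic) x : R.
  have mB : measurable_fun Rplus B.
    by apply: measurable_funM => //; apply: measurable_indic; exact: measurable_itv.
  apply: (@energy_dominated _ _ _ p_gt1 w_gt0 w_cont _ B).
  - move=> i; apply: measurable_funB => //; apply: measurable_funTS.
    apply: continuous_measurable_fun; apply: smooth_continuous.
    exact/elementary_smooth/elementary_step_approx.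
  - exact: mB.
  - apply: (@energy_bounded_fin _ c (d + (d - c)) (2 * N%:R)) => //.
    + move=> x _; rewrite /B normrM ger0_norm ?mulr_ge0// ler_piMr ?mulr_ge0//.
      by rewrite ger0_norm indicE ?ler0n// lern1; case: (_ \in _).
    + move=> x hx; rewrite /B indicE memNset ?mulr0//= in_itv/=.
      by case: hx => [xc|dx]; apply/negP; rewrite negb_and -leNgt -ltNge ?xc ?dx ?orbT.
  - move=> i x x0; have [xin|xout] := boolP (x \in `]c, d + (d - c)]%classic).
      rewrite /B indicE xin mulr1 [leRHS]ger0_norm ?mulr_ge0//.
      rewrite /= (le_trans (ler_normB _ _))// mulr2n mulrDl mul1r lerD//.
        by rewrite patchE; case: ifP => _; rewrite ?GN ?normr0.
      exact: step_approx_le.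
    have hx : x <= c \/ d + (d - c) < x.
      by move: xout; rewrite notin_setE/= in_itv/= => /negP;
        rewrite negb_and -leNgt -ltNge => /orP.
    rewrite /= patchE ifF; last first.
      apply/negbTE; rewrite notin_setE/= in_itv/=; apply/negP; rewrite negb_and -leNgt -ltNge.
      by case: hx => h1; apply/orP; [left|right; lra].
    rewrite (step_approx0 _ cd) ?subrr ?normr0//.
    by case: hx => [|/ltW]; [left|right].
  - move=> x x0; rewrite -(subrr ((G n \_ `]c, d]) x)).
    by apply: cvgB; [exact: cvg_cst|exact: step_approx_cvg].
exists (step_approx (G n) c d j); split.
- exact: elementary_step_approx.
- by move=> x; exact: step_approx0.
have mS : measurable_fun Rplus (step_approx (G n) c d j).
  apply: measurable_funTS; apply: continuous_measurable_fun; apply: smooth_continuous.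
  exact/elementary_smooth/elementary_step_approx.
have -> : h \- step_approx (G n) c d j = (h \- T N) \+
    ((T N \- G n \_ `]c, d]) \+ (G n \_ `]c, d] \- step_approx (G n) c d j)).
  by apply/funext => x /=; ring.
apply: le_trans (energyD p_gt1 w_gt0 w_cont _ _) _; [exact: measurable_funB| |].
  by apply: measurable_funD; exact: measurable_funB.
have -> : e%:E = (K%:E * (e1%:E + K%:E * (e1%:E + e1%:E)))%E.
  transitivity ((K * (e1 + K * (e1 + e1)))%:E); last by [].
  congr EFin; rewrite /e1; field; by rewrite gt_eqF// addr_gt0// mulr_gt0// addr_gt0.
apply: lee_wpmul2l; first by rewrite lee_fin ltW.
apply: (leeD (ltW TN)).
apply: le_trans (energyD p_gt1 w_gt0 w_cont _ _) _;
  [exact: measurable_funB|exact: measurable_funB|].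
apply: lee_wpmul2l; first by rewrite lee_fin ltW.
exact: leeD (ltW Gn) (ltW Gj).
Qed.
End smoothing.

(** * The conjugate weight *)

Section conjugate_weight.
Context {R : realType}.
Local Notation mu := (@lebesgue_measure R).
Variables (p : R) (w : R -> R).
Hypothesis p_gt1 : 1 < p.
Hypothesis w_gt0 : forall t : R, 0 < t -> 0 < w t.
Hypothesis w_cont : {within Rplus, continuous w}.
Implicit Types (f g h u : R -> R) (a b c d x y : R) (E : set R).
Local Notation energy := (weighted_energy p w).
Let mR := @measurable_Rplus R.
Hint Resolve mR : core.
Let p0 : 0 < p. Proof. exact: lt_trans p_gt1. Qed.
Let pB1 : 0 < p - 1. Proof. by rewrite subr_gt0. Qed.

Definition dual_weight x : R := w x `^ (- (p - 1)^-1).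

Local Notation conj_weight := dual_weight.

Lemma conj_weight_gt0 x : 0 < x -> 0 < conj_weight x.
Proof. by move=> x0; rewrite powR_gt0// w_gt0. Qed.

Lemma measurable_conj_weight : measurable_fun Rplus conj_weight.
Proof.
by apply: (measurableT_comp (measurable_powR _)); exact: measurable_weight.
Qed.

Lemma conj_weight_powR x : 0 < x -> conj_weight x `^ (p - 1) * w x = 1.
Proof.
move=> x0; rewrite /dual_weight -powRrM mulNr mulVf ?gt_eqF//.
by rewrite powR_inv1 ?mulVf// ?gt_eqF ?ltW ?w_gt0.
Qed.

Lemma conj_weight_energy x : 0 < x -> conj_weight x `^ p * w x = conj_weight x.
Proof.
move=> x0; rewrite -[conj_weight x `^ p](mulr_powRB1 (ltW (conj_weight_gt0 x0)) p0).
by rewrite -mulrA conj_weight_powR// mulr1.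
Qed.

(** Either [l a <= sigma], and the second term suffices, or [(l a)^(p-1) w >=
    sigma^(p-1) w = 1], and the first one does. This replaces the inequality
    of Hoelder. *)
Lemma norm_le_energy_conj_weight (l a x : R) : 0 < l -> 0 <= a -> 0 < x ->
  a <= l `^ (p - 1) * (a `^ p * w x) + l^-1 * conj_weight x.
Proof.
move=> l0 a0 x0; have s0 := conj_weight_gt0 x0.
have h0 : 0 <= l `^ (p - 1) * (a `^ p * w x).
  by rewrite !mulr_ge0 ?powR_ge0// ltW// w_gt0.
have [le_a|lt_a] := leP a (l^-1 * conj_weight x).
  by apply: le_trans le_a _; rewrite lerDr.
apply: (@le_trans _ _ (l `^ (p - 1) * (a `^ p * w x))); last first.
  by rewrite lerDl mulr_ge0 ?invr_ge0 ?ltW.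
rewrite -[a `^ p](mulr_powRB1 a0 p0) mulrCA -{1}[a]mulr1 -!mulrA ler_wpM2l//.
rewrite mulrA -powRM ?(ltW l0)// -[leLHS](conj_weight_powR x0) ler_wpM2r//.
  by rewrite ltW// w_gt0.
have sl : conj_weight x <= a * l by rewrite mulrC -ler_pdivrMl// ltW.
by apply: ge0_ler_powR; rewrite ?nnegrE ?(ltW pB1) ?(ltW s0) ?mulr_ge0// ltW.
Qed.

Lemma integral_norm_le E f (l : R) : measurable (E : set (measurableTypeR R)) ->
  E `<=` Rplus -> measurable_fun Rplus f -> 0 < l ->
  (\int[mu]_(x in E) `|f x|%:E <=
   (l `^ (p - 1))%:E * energy f + (l^-1)%:E * \int[mu]_(x in E) (conj_weight x)%:E)%E.
Proof.
move=> mE ER mf l0.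
have l1 : 0 <= l^-1 by rewrite invr_ge0 ltW.
have mfE : measurable_fun E f by exact: measurable_funS mR ER mf.
have mF : measurable_fun E (fun t => (`|f t| `^ p * w t)%:E).
  exact: measurable_funS mR ER (measurable_energy p w_cont mf).
have mS : measurable_fun E (fun t => (conj_weight t)%:E).
  by apply/measurable_EFinP; exact: measurable_funS mR ER measurable_conj_weight.
have F0 x : Rplus x -> (0 <= (`|f x| `^ p * w x)%:E)%E.
  by rewrite RplusE => x0; rewrite lee_fin mulr_ge0 ?powR_ge0// ltW// w_gt0.
have S0 x : Rplus x -> (0 <= (conj_weight x)%:E)%E.
  by rewrite RplusE => x0; rewrite lee_fin ltW// conj_weight_gt0.
apply: (@le_trans _ _ (\int[mu]_(x in E) ((l `^ (p - 1))%:E * (`|f x| `^ p * w x)%:E +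
  (l^-1)%:E * (conj_weight x)%:E))%E).
  apply: ge0_le_integral => //.
  - by apply/measurable_EFinP; exact: measurableT_comp.
  - by apply: emeasurable_funD; exact: measurable_funeM.
  - move=> x /ER; rewrite RplusE => x0; rewrite -!EFinM -EFinD lee_fin.
    exact: norm_le_energy_conj_weight.
rewrite ge0_integralD//; last 4 first.
- by move=> x /ER Rx; rewrite mule_ge0 ?lee_fin ?powR_ge0// -lee_fin F0.
- exact: measurable_funeM.
- by move=> x /ER Rx; rewrite mule_ge0 ?lee_fin// -lee_fin S0.
- exact: measurable_funeM.
rewrite !ge0_integralZl//; [|by move=> x /ER; exact: S0
  |by move=> x /ER; exact: F0|by rewrite lee_fin powR_ge0].
apply: leeD => //.
apply: lee_wpmul2l; first by rewrite lee_fin powR_ge0.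
apply: ge0_subset_integral => //.
exact: measurable_energy.
Qed.

Lemma integrable_of_energy E f : measurable (E : set (measurableTypeR R)) ->
  E `<=` Rplus -> measurable_fun Rplus f -> (energy f < +oo)%E ->
  (\int[mu]_(x in E) (conj_weight x)%:E < +oo)%E ->
  mu.-integrable E (EFin \o f).
Proof.
move=> mE ER mf fin Efin; apply/integrableP; split.
  by apply/measurable_EFinP; exact: measurable_funS mR ER mf.
apply: le_lt_trans (integral_norm_le mE ER mf ltr01) _.
by rewrite powR1 invr1 !mul1e lte_add_pinfty.
Qed.

(** In [integral_norm_le] the parameter [l] is first chosen large to make the
    term in [sigma] small, then the energy small. *)
Lemma integral_norm_small E (e : R) : measurable (E : set (measurableTypeR R)) ->
  E `<=` Rplus -> (\int[mu]_(x in E) (conj_weight x)%:E < +oo)%E -> 0 < e ->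
  exists2 d : R, 0 < d & forall f, measurable_fun Rplus f -> (energy f <= d%:E)%E ->
    (\int[mu]_(x in E) `|f x|%:E <= e%:E)%E.
Proof.
move=> mE ER Efin e0.
have I0 : (0 <= \int[mu]_(x in E) (conj_weight x)%:E)%E.
  by apply: integral_ge0 => x /ER; rewrite RplusE => x0; rewrite lee_fin ltW// conj_weight_gt0.
have Ifin : (\int[mu]_(x in E) (conj_weight x)%:E)%E \is a fin_num by rewrite ge0_fin_numE.
pose I := fine (\int[mu]_(x in E) (conj_weight x)%:E)%E.
have IE : (\int[mu]_(x in E) (conj_weight x)%:E)%E = I%:E by rewrite fineK.
have I_ge0 : 0 <= I by rewrite fine_ge0.
(* With this [l] the term in [sigma] is at most [e / 2], also when [I = 0]. *)
pose l : R := 2 * (I + 1) / e.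
have l0 : 0 < l by rewrite divr_gt0// mulr_gt0// ltr_wpDl.
have lp : 0 < l `^ (p - 1) by rewrite powR_gt0.
exists (e / 2 / l `^ (p - 1)); first by rewrite !divr_gt0.
move=> f mf fd; apply: le_trans (integral_norm_le mE ER mf l0) _.
rewrite IE; apply: (@le_trans _ _ ((l `^ (p - 1))%:E * (e / 2 / l `^ (p - 1))%:E +
  (l^-1)%:E * I%:E)%E).
  by apply: leeD => //; apply: lee_wpmul2l => //; rewrite lee_fin ltW.
rewrite -!EFinM -EFinD lee_fin [l `^ _ * _]mulrC divfK ?gt_eqF//.
rewrite [leRHS](splitr e) lerD2l.
rewrite /l invf_div mulrAC ler_pdivrMr ?mulr_gt0 ?ltr_wpDl//.
by nra.
Qed.

Lemma wLnorm_le f (e : R) : 0 <= e -> (energy f <= (e `^ p)%:E)%E <-> (wLnorm p w f <= e%:E)%E.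
Proof.
move=> e0; rewrite wLnormE; have f0 := energy_ge0 p w_gt0 f.
have mono (r : R) (x y : \bar R) : 0 <= r -> (0 <= x)%E -> (0 <= y)%E -> (x <= y)%E ->
  (x `^ r <= y `^ r)%E.
  by move=> r0 x0 y0; apply: gt0_ler_poweR => //; rewrite in_itv/= ?x0 ?y0 leey.
split => h.
  have := mono p^-1 _ _ _ f0 _ h; rewrite poweR_EFin -powRrM mulfV ?gt_eqF// powRr1//.
  by apply; rewrite ?lee_fin ?powR_ge0// invr_ge0 ltW.
have := mono p _ _ (ltW p0) (poweR_ge0 _ _) _ h.
by rewrite -poweRrM mulVf ?gt_eqF// poweRe1// poweR_EFin; apply; rewrite lee_fin.
Qed.

End conjugate_weight.

(** * From densities to test functions *)

Section primitive.
Context {R : realType}.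
Local Notation mu := (@lebesgue_measure R).
Implicit Types (f g h u psi : R -> R) (a b c d x y : R).

Lemma Rintegral_support (A B : set R) f : A `<=` B ->
  (forall x, B x -> ~ A x -> f x = 0) ->
  \int[mu]_(t in B) f t = \int[mu]_(t in A) f t.
Proof.
move=> AB f0; rewrite Rintegral_mkcond [RHS]Rintegral_mkcond.
apply: eq_Rintegral => t _; rewrite !patchE.
have [tA|tA] := pselect (A t); first by rewrite !mem_set//; exact: AB.
rewrite [in RHS]memNset//; have [tB|tB] := pselect (B t); last by rewrite memNset.
by rewrite mem_set// f0.
Qed.

Lemma continuous_support_integrable psi c d : continuous psi ->
  (forall x, x <= c \/ d <= x -> psi x = 0) -> mu.-integrable setT (EFin \o psi).
Proof.
move=> cpsi psi0.
have := @continuous_compact_integrable R psi _ (@segment_compact _ c d)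
  (continuous_subspaceT cpsi).
rewrite integrable_mkcond; last exact: measurable_itv.
congr (mu.-integrable _ _); apply/funext => x; rewrite patchE.
case: ifPn => //; rewrite notin_setE/= in_itv/= => /negP.
rewrite negb_and -!ltNge => /orP[xc|dx]; rewrite /comp psi0//; [left|right]; exact: ltW.
Qed.

Definition primitive psi x : R := \int[mu]_(t in `]-oo, x]) psi t.

Lemma is_derive_primitive psi c d x : continuous psi ->
  (forall x, x <= c \/ d <= x -> psi x = 0) ->
  is_derive x 1 (primitive psi) (psi x).
Proof.
move=> cpsi psi0; have ipsi := continuous_support_integrable cpsi psi0.
have [] := @continuous_FTC1 R psi -oo%O x (x + 1).
- by rewrite ltrDl.
- by apply: integrableS ipsi.
- by rewrite ltNyr.
- exact: cpsi.
by move=> dP dE; split; [exact: dP|rewrite -derive1E dE].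
Qed.

Lemma primitive_oc psi c x : (forall x, x <= c -> psi x = 0) ->
  primitive psi x = \int[mu]_(t in `]c, x]) psi t.
Proof.
move=> psi0; apply: Rintegral_support => t /=; rewrite !in_itv/=.
  by case/andP.
by move=> tx /negP; rewrite tx andbT -leNgt; exact: psi0.
Qed.

Lemma Rintegral_oc_right h c d x : d <= x -> (forall x, d < x -> h x = 0) ->
  \int[mu]_(t in `]c, x]) h t = \int[mu]_(t in `]c, d]) h t.
Proof.
move=> dx h0; apply: Rintegral_support => t /=; rewrite !in_itv/=.
  by move=> /andP[-> td]; exact: le_trans dx.
by move=> /andP[-> _] /negP; rewrite -ltNge; exact: h0.
Qed.

Lemma Rintegral_oc0 h c x : x <= c -> \int[mu]_(t in `]c, x]) h t = 0.
Proof. by move=> xc; rewrite set_itv_ge ?Rintegral_set0// bnd_simp -leNgt. Qed.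

End primitive.

Section test_functions.
Context {R : realType}.
Local Notation mu := (@lebesgue_measure R).
Variables (p : R) (w : R -> R).
Hypothesis p_gt1 : 1 < p.
Hypothesis w_gt0 : forall t : R, 0 < t -> 0 < w t.
Hypothesis w_cont : {within Rplus, continuous w}.
Implicit Types (f g h u psi : R -> R) (a b c d x y : R).
Local Notation energy := (weighted_energy p w).
Local Notation conj_weight := (dual_weight p w).
Let mR := @measurable_Rplus R.
Hint Resolve mR : core.

Lemma energy_continuous_fin f c d : 0 < c -> c <= d -> continuous f ->
  (forall x, x <= c \/ d < x -> f x = 0) -> (energy f < +oo)%E.
Proof.
move=> c0 cd cf f0.
have cnf : {within `[c, d], continuous (fun x => `|f x|)}.
  by apply: continuous_subspaceT => x; apply: cvg_norm; exact: cf.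
have [M _ HM] := EVT_max cd cnf.
apply: (@energy_bounded_fin _ _ _ p_gt1 w_gt0 w_cont f c d `|f M|) => //.
  by apply: measurable_funTS; exact: continuous_measurable_fun.
move=> x x0; have [xcd|] := boolP (x \in `[c, d]%R); first exact: HM.
rewrite in_itv/= negb_and -!ltNge => /orP[xc|dx]; rewrite f0 ?normr0//; last by right.
by left; exact: ltW.
Qed.

Lemma conj_weight_compact_fin c d : 0 < c ->
  (\int[mu]_(x in `]c, d]) (conj_weight x)%:E < +oo)%E.
Proof.
move=> c0; have [M M0 wM] := weight_bounded w_gt0 w_cont d c0.
have mcd : measurable (`]c, d]%classic : set (measurableTypeR R)) by exact: measurable_itv.
have sub := @itv_Rplus _ c d (ltW c0).
apply: (@le_lt_trans _ _ (\int[mu]_(x in `]c, d]) (M `^ (p - 1)^-1)%:E)%E); last first.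
  rewrite integral_cst//= lebesgue_measure_itv/=.
  by case: ifP => _; rewrite ?mule0 ?ltry// -EFinB -!EFinM ltry.
apply: ge0_le_integral => //.
- by move=> x /sub; rewrite RplusE => x0; rewrite lee_fin ltW// conj_weight_gt0.
- by apply/measurable_EFinP; apply: measurable_funS mR sub _; exact: measurable_conj_weight.
move=> x; rewrite /= in_itv/= => /andP[cx xd]; rewrite lee_fin /dual_weight powRN.
have x0 : 0 < x by exact: lt_trans cx.
have wx := w_gt0 x0.
have [_] := wM x (introT andP (conj (ltW cx) xd)); rewrite -div1r ler_pdivrMr// => Mw.
set q := (p - 1)^-1; have q0 : 0 <= q by rewrite invr_ge0 subr_ge0 ltW.
rewrite -[leLHS]mul1r ler_pdivrMr ?powR_gt0// -powRM ?(ltW M0) ?(ltW wx)// mulrC.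
have <- : 1 `^ q = 1 :> R by rewrite powR1.
by apply: ge0_ler_powR; rewrite ?nnegrE ?mulr_ge0 ?(ltW M0) ?(ltW wx).
Qed.

Lemma support_test_function phi c d : smooth phi -> 0 < c ->
  (forall x, x < c \/ d < x -> phi x = 0) -> test_function phi.
Proof.
move=> sphi c0 phi0.
have sub : closure [set x | phi x != 0] `<=` `[c, d].
  have <- : closure `[c, d]%classic = `[c, d]%classic.
    by apply/esym/closure_id; exact: itv_closed.
  apply: closure_subset => x /= nz; rewrite in_itv/=; apply/andP; split;
    rewrite leNgt; apply/negP => h; move: nz; rewrite phi0 ?eqxx//; [by left|by right].
split => //.
- apply: subclosed_compact sub; [exact: closed_closure|exact: segment_compact].
- move=> x /sub; rewrite /= in_itv/= RplusE => /andP[+ _]; exact: lt_le_trans.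
Qed.

(** The derivative of the step between [1] and [2] is a smooth density of
    total mass one, by which the mean of other densities is corrected. *)
Lemma step1_derive : exists2 kappa, elementary kappa &
  (forall x, is_derive x 1 (fun x : R => step (x - 1)) (kappa x)) /\ (energy kappa < +oo)%E.
Proof.
have -> : (fun x : R => step (x - 1)) = (fun x => step (1 * x + (- 1))).
  by apply/funext => x; rewrite mul1r.
have [k ek dk] := elementary_derive (elementary_step 1 (-1 : R)).
exists k => //; split => //.
apply: (@energy_continuous_fin _ 2^-1 2) => //.
- lra.
- exact/smooth_continuous/elementary_smooth.
move=> x hx; have [_ <-] := dk x.
have [z E] : exists z, \forall y \near x, step (1 * y + (-1)) = cst z y.
  case: hx => [x1|x2].
    exists 0; near=> y; rewrite /= step_le0//.
    have : y < 1 by near: y; apply: lt_nbhsl; lra.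
    lra.
  exists 1; near=> y; rewrite /= step_ge1//.
  have : 2 < y by near: y; apply: lt_nbhsr.
  lra.
by rewrite (near_eq_derive _ E) derive_cst.
Unshelve. all: by end_near. Qed.

(** The test function is the primitive of a smooth [psi] close to [h], minus
    its final value [m] times the step between [1] and [2]: this makes it
    vanish beyond the supports. As [m] is small, the correction costs little
    energy, uniformly in the interval carrying [h]. *)
Lemma test_function_near (e : R) : 0 < e -> exists2 eta : R, 0 < eta &
  forall v u h a b c d, 0 < c -> c <= a -> b <= d -> c < d ->
  measurable_fun Rplus v -> measurable_fun Rplus h -> (energy h < +oo)%E ->
  (forall x, x <= c \/ d < x -> h x = 0) ->
  (energy (h \- v)%R <= eta%:E)%E ->
  (forall x, a <= x <= b -> `|\int[mu]_(t in `]c, x]) h t - u x| <= eta) ->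
  `|\int[mu]_(t in `]c, d]) h t| <= eta ->
  exists phi, [/\ test_function phi,
    (energy (derive1 phi \- v)%R <= e%:E)%E &
    forall x, a <= x <= b -> `|phi x - u x| <= e].
Proof.
move=> e0; have [kappa ek [dk kfin]] := step1_derive.
pose Ek := fine (energy kappa).
have EkE : energy kappa = Ek%:E by rewrite fineK// ge0_fin_numE// energy_ge0.
have Ek0 : 0 <= Ek by rewrite fine_ge0// energy_ge0.
have K0 : 0 < 2 `^ p :> R by rewrite powR_gt0.
set K : R := 2 `^ p in K0.
pose C := K * (1 + K * (1 + 2 * Ek)).
have C0 : 0 < C by rewrite /C mulr_gt0// ltr_wpDr// mulr_ge0 ?ltW// ltr_wpDr// mulr_ge0.
(* The energy is at most [C * eta] and the uniform distance at most
   [4 * eta]; the bound [1 / 2] gives [|m| <= 1], hence [|m|^p <= |m|]. *)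
pose eta := Num.min (1 / 2) (Num.min (e / 4) (e / C)).
have eta0 : 0 < eta by rewrite !lt_min !divr_gt0.
have eta1 : eta <= 1 / 2 by rewrite ge_min lexx.
have eta2 : 4 * eta <= e.
  by rewrite mulrC -ler_pdivlMr// !ge_min lexx orbT.
have eta3 : eta * C <= e by rewrite -ler_pdivlMr// !ge_min lexx !orbT.
exists eta => // v u h a b c d c0 ca bd cd mv mh hfin h0 hv hu hd.
pose d' := d + (d - c).
have dd' : d <= d' by rewrite lerDl subr_ge0 ltW.
have mcd : measurable (`]c, d']%classic : set (measurableTypeR R)) by exact: measurable_itv.
have sub := @itv_Rplus _ c d' (ltW c0).
have cwfin := conj_weight_compact_fin d' c0.
have [d1 d10 Hd1] := integral_norm_small p_gt1 w_gt0 w_cont mcd sub cwfin eta0.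
have [|psi [epsi psi0 hpsi]] := smooth_dense p_gt1 w_gt0 w_cont c0 cd _ mh hfin h0 (e :=
  Num.min eta d1).
  by rewrite lt_min eta0.
have cpsi : continuous psi by exact/smooth_continuous/elementary_smooth.
have mpsi : measurable_fun Rplus psi.
  by apply: measurable_funTS; exact: continuous_measurable_fun.
have L1 : (\int[mu]_(x in `]c, d']) `|(h \- psi)%R x|%:E <= eta%:E)%E.
  apply: Hd1; first exact: measurable_funB.
  by apply: le_trans hpsi _; rewrite lee_fin ge_min lexx orbT.
have psil x : x <= c -> psi x = 0 by move=> xc; apply: psi0; left.
have psir x : d' < x -> psi x = 0 by move=> /ltW xd; apply: psi0; right.
have hr x : d < x -> h x = 0 by move=> xd; apply: h0; right.
have ih : mu.-integrable `]c, d'] (EFin \o h)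
  by exact: (integrable_of_energy p_gt1 w_gt0 w_cont mcd sub mh hfin cwfin).
have ipsi : mu.-integrable `]c, d'] (EFin \o psi).
  by apply: integrableS (continuous_support_integrable cpsi psi0).
have Pclose x : x <= d' -> `|primitive psi x - \int[mu]_(t in `]c, x]) h t| <= eta.
  move=> xd; rewrite (primitive_oc _ psil).
  have subx : `]c, x] `<=` `]c, d']%classic by apply: subset_itvl; rewrite bnd_simp.
  have mx : measurable (`]c, x]%classic : set (measurableTypeR R)) by exact: measurable_itv.
  have ihx := integrableS mcd mx subx ih; have ipx := integrableS mcd mx subx ipsi.
  rewrite -RintegralB// -lee_fin.
  have iB : mu.-integrable `]c, x] (EFin \o (psi \- h)).
    have := integrableB mx ipx ihx; exact: eq_integrable.
  apply: (@le_trans _ _ (\int[mu]_(t in `]c, x]) `|psi t - h t|)%:E).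
    by rewrite lee_fin; exact: le_normr_Rintegral.
  rewrite /Rintegral fineK; last first.
    by rewrite ge0_fin_numE; [case/integrableP: iB|exact: integral_ge0].
  apply: le_trans L1; under eq_integral do rewrite distrC.
  apply: ge0_subset_integral => //.
  apply/measurable_EFinP; apply: measurableT_comp => //; apply: measurable_funS mR sub _.
  exact: measurable_funB.
pose m := primitive psi d'.
have m2 : `|m| <= 2 * eta.
  have := Pclose d' (lexx _); rewrite (Rintegral_oc_right _ dd' hr) -/m => h1.
  by rewrite -[m](subrK (\int[mu]_(t in `]c, d]) h t)) (le_trans (ler_normD _ _))// mulr2n
    mulrDl mul1r lerD.
pose g := psi \+ (cst (- m) \* kappa).
have eg : elementary g by apply: elem_add => //; apply: elem_mul => //; exact: elem_cst.
pose phi x := primitive psi x - m * step (x - 1).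
have dphi x : is_derive x 1 phi (g x).
  have D1 := is_derive_primitive x cpsi psi0.
  have D2 := is_deriveM (is_derive_cst m x 1) (dk x).
  apply: is_derive_eq (is_deriveB D1 D2) _.
  by rewrite /g/= /GRing.scale/= mulr0 addr0 mulNr.
have phiE : derive1 phi = g by apply/funext => x; rewrite derive1E; have [] := dphi x.
exists phi; split.
- apply: (@support_test_function phi (Num.min c 1) (Num.max d' 2)).
  + by apply: smooth_primitive dphi _; exact: elementary_smooth.
  + by rewrite lt_min c0 ltr01.
  + move=> x [|]; rewrite ?lt_min ?gt_max => /andP[h1 h2]; rewrite /phi.
      rewrite (primitive_oc _ psil) Rintegral_oc0 ?ltW// step_le0 ?mulr0 ?subrr//; lra.
    rewrite (primitive_oc _ psil) (Rintegral_oc_right _ (ltW h1) psir) -(primitive_oc _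
      psil) step_ge1 ?mulr1 ?subrr//.
    lra.
- rewrite phiE.
  have mk : measurable_fun Rplus kappa.
    by apply: measurable_funTS; apply: continuous_measurable_fun;
      exact/smooth_continuous/elementary_smooth.
  have mmk : measurable_fun Rplus (fun x => - m * kappa x).
    by apply: measurable_funM => //.
  have -> : g \- v = (psi \- h) \+ ((h \- v) \+ (fun x => - m * kappa x)).
    by apply/funext => x; rewrite /g/=; ring.
  apply: le_trans (energyD p_gt1 w_gt0 w_cont _ _) _; [exact: measurable_funB| |].
    by apply: measurable_funD => //; exact: measurable_funB.
  apply: (@le_trans _ _ (K%:E * (eta%:E + K%:E * (eta%:E + (2 * eta * Ek)%:E)))%E); last first.
    rewrite [leLHS](_ : _ = (K * (eta + K * (eta + 2 * eta * Ek)))%:E)// lee_fin.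
    by apply: le_trans eta3; rewrite le_eqVlt; apply/orP; left; apply/eqP; rewrite /C; ring.
  apply: lee_wpmul2l; first by rewrite lee_fin ltW.
  apply: leeD.
    by rewrite energyB_sym; apply: le_trans hpsi _; rewrite lee_fin ge_min lexx.
  apply: le_trans (energyD p_gt1 w_gt0 w_cont _ mmk) _; first exact: measurable_funB.
  apply: lee_wpmul2l; first by rewrite lee_fin ltW.
  apply: leeD => //.
  rewrite (energy_scale p w_gt0 w_cont)// EkE -EFinM lee_fin ler_wpM2r// normrN.
  apply: (le_trans _ m2).
  have [->|m0] := eqVneq m 0; first by rewrite normr0 powR0// gt_eqF// (lt_trans _ p_gt1).
  apply: ge1r_powR; last exact: ltW.
  by rewrite normr_gt0 m0/= (le_trans m2)//; lra.
- move=> x /[dup] xab /andP[ax xb].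
  have xd : x <= d' by apply: le_trans xb (le_trans bd dd').
  apply: le_trans eta2; have := Pclose x xd; have := hu x xab.
  set I := \int[mu]_(t in _) _ => h1 h2.
  have -> : phi x - u x = (primitive psi x - I) + ((I - u x) - m * step (x - 1)).
    by rewrite /phi; ring.
  have h3 : `|m * step (x - 1)| <= 2 * eta.
    by rewrite normrM [X in _ * X]ger0_norm ?step_ge0//; apply: (le_trans _ m2);
      rewrite ler_piMr// step_le1.
  have := ler_normD (primitive psi x - I) ((I - u x) - m * step (x - 1)).
  have := ler_normB (I - u x) (m * step (x - 1)).
  lra.
Qed.
End test_functions.

(** * Reaching a prescribed value at small energy *)

Section filling.
Context {R : realType}.
Local Notation mu := (@lebesgue_measure R).
Variables (p : R) (w : R -> R).
Hypothesis p_gt1 : 1 < p.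
Hypothesis w_gt0 : forall t : R, 0 < t -> 0 < w t.
Hypothesis w_cont : {within Rplus, continuous w}.
Implicit Types (f g h u psi : R -> R) (a b c d x y : R).
Local Notation energy := (weighted_energy p w).
Local Notation conj_weight := (dual_weight p w).
Let mR := @measurable_Rplus R.
Hint Resolve mR : core.
Let p0 : 0 < p. Proof. exact: lt_trans p_gt1. Qed.
Let pB1 : 0 < p - 1. Proof. by rewrite subr_gt0. Qed.

Lemma measurable_patch_oc f s t : 0 <= s -> measurable_fun Rplus f ->
  measurable_fun Rplus (f \_ `]s, t]).
Proof.
move=> s0 mf; apply: measurable_funTS; apply/(measurable_restrictT _ _).1.
  exact: measurable_itv.
by apply: measurable_funS mR _ mf; exact: itv_Rplus.
Qed.

Lemma energy_patch_oc f s t : 0 <= s ->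
  energy (f \_ `]s, t]) = (\int[mu]_(x in `]s, t]) (`|f x| `^ p * w x)%:E)%E.
Proof.
move=> s0; rewrite /weighted_energy [LHS]integral_mkcond [RHS]integral_mkcond.
apply: eq_integral => x _; rewrite !patchE.
have [xin|xout] := boolP (x \in `]s, t]%classic).
  by rewrite mem_set//; apply: (@itv_Rplus _ s t) => //; exact: set_mem.
by rewrite normr0 powR0 ?gt_eqF// mul0r; case: ifP.
Qed.

(** A density [g] carried by the interval [(s, t]] which joins the values [0]
    and [v] up to [e], with energy at most [e]. *)
Definition fills (e s t v : R) g := [/\ measurable_fun Rplus g,
  forall x, x <= s \/ t < x -> g x = 0, (energy g <= e%:E)%E &
  `|\int[mu]_(x in `]s, t]) g x - v| <= e].

Lemma fills0 e s t v : `|v| <= e -> fills e s t v (cst 0).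
Proof.
move=> ve; have e0 : 0 <= e by exact: le_trans ve.
split => //.
- rewrite (_ : energy _ = 0%E) ?lee_fin//; apply: integral0_eq => x _.
  by rewrite normr0 powR0 ?mul0r// gt_eqF.
- by rewrite (_ : \int[mu]_(x in _) _ = 0) ?sub0r ?normrN// /Rintegral integral0.
Qed.

(** The quantity is the energy of the multiple of [sigma] of integral [v] on a
    set of [sigma]-mass [I], because [sigma^p w = sigma]. It is [|v| (|v| /
    I)^(p-1)], which tends to [0] as [I] grows since [p > 1]. *)
Lemma large_mass_cheap (v e : R) : 0 < e -> exists2 T : R, 0 < T &
  forall I : R, T <= I -> `|v / I| `^ p * I <= e.
Proof.
move=> e0.
have v1 : 0 < `|v| + 1 by rewrite ltr_wpDl.
(* So that [|v| / I <= eta] yields [|v| (|v| / I)^(p-1) <= e]. *)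
pose eta := (e / (`|v| + 1)) `^ (p - 1)^-1.
have eta0 : 0 < eta by apply: powR_gt0; rewrite divr_gt0.
exists (`|v| / eta + 1); first by rewrite ltr_wpDl// divr_ge0// ltW.
move=> I TI; have I0 : 0 < I by apply: lt_le_trans TI; rewrite ltr_wpDl// divr_ge0// ltW.
rewrite normrM normfV (gtr0_norm I0).
rewrite -(mulr_powRB1 _ p0) ?divr_ge0 ?(ltW I0)// mulrAC divfK ?gt_eqF//.
have vI : `|v| / I <= eta.
  rewrite ler_pdivrMr// mulrC -ler_pdivrMr//; apply: le_trans TI; by rewrite lerDl.
apply: (@le_trans _ _ (`|v| * (e / (`|v| + 1)))).
  rewrite ler_wpM2l//.
  have -> : e / (`|v| + 1) = eta `^ (p - 1).
    by rewrite /eta -powRrM mulVf ?gt_eqF// powRr1// divr_ge0// ltW.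
  by apply: ge0_ler_powR; rewrite ?nnegrE ?(ltW pB1) ?(ltW eta0) ?divr_ge0 ?(ltW I0).
by rewrite mulrCA ger_pMr// ler_pdivrMr// mul1r lerDl.
Qed.

Lemma fills_divergent (s t : nat -> R) (E : set R) e v : 0 < e ->
  (forall n, 0 < s n) ->
  {homo (fun n => `]s n, t n]%classic) : n m / (n <= m)%N >-> (n <= m)%O} ->
  \bigcup_n `]s n, t n]%classic = E ->
  (\int[mu]_(x in E) (conj_weight x)%:E = +oo)%E ->
  exists n g, fills e (s n) (t n) v g.
Proof.
move=> e0 s0 homE UE intE.
have mF n : measurable (`]s n, t n]%classic : set (measurableTypeR R)) by exact: measurable_itv.
have sub n : `]s n, t n] `<=` Rplus by apply: itv_Rplus; exact: ltW.
have mC n : measurable_fun `]s n, t n] (fun x => (conj_weight x)%:E).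
  by apply/measurable_EFinP; apply: measurable_funS mR (sub n) _; exact: measurable_conj_weight.
have C0 n x : `]s n, t n]%classic x -> (0 <= (conj_weight x)%:E)%E.
  by move=> /sub; rewrite RplusE => x0; rewrite lee_fin ltW// conj_weight_gt0.
have cv := ge0_nondecreasing_set_cvg_integral (mu := mu) homE mF mC C0.
have [T T0 HT] := large_mass_cheap v e0.
move: cv; rewrite UE intE => /cvgeyPge /(_ T) [n _ /(_ n (leqnn n)) Tn].
exists n.
have Ifin : (\int[mu]_(x in `]s n, t n]) (conj_weight x)%:E < +oo)%E.
  exact: conj_weight_compact_fin.
pose I := fine (\int[mu]_(x in `]s n, t n]) (conj_weight x)%:E)%E.
have IE : (\int[mu]_(x in `]s n, t n]) (conj_weight x)%:E)%E = I%:E.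
  by rewrite fineK// ge0_fin_numE// integral_ge0//; exact: C0.
have TI : T <= I by rewrite -lee_fin -IE.
have I0 : 0 < I by exact: lt_le_trans TI.
exists (fun x => (v / I) * (conj_weight \_ `]s n, t n]) x).
have mc : measurable_fun Rplus (conj_weight \_ `]s n, t n]).
  by apply: measurable_patch_oc; [exact: ltW|exact: measurable_conj_weight].
split.
- exact: measurable_funM.
- move=> x hx; rewrite patchE memNset ?mulr0//= in_itv/=.
  by case: hx => h; apply/negP; rewrite negb_and -leNgt -ltNge h ?orbT.
- rewrite (energy_scale p w_gt0 w_cont)// energy_patch_oc; last exact: ltW.
  rewrite (_ : (\int[mu]_(x in _) _)%E = I%:E); last first.
    rewrite -IE; apply: eq_integral => x /set_mem /sub; rewrite RplusE => x0.
    by rewrite ger0_norm ?conj_weight_energy// ltW// conj_weight_gt0.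
  by rewrite -EFinM lee_fin HT.
- rewrite (_ : \int[mu]_(x in _) _ = v) ?subrr ?normr0 ?(ltW e0)//.
  rewrite RintegralZl//; last first.
    apply/integrableP; split.
      by apply/measurable_EFinP; exact: measurable_funS mR (sub n) mc.
    apply: le_lt_trans Ifin; rewrite le_eqVlt; apply/orP; left; apply/eqP;
      apply: eq_integral => x xin.
    rewrite /= patchE xin ger0_norm//; move: xin => /set_mem /sub; rewrite RplusE => x0.
    by rewrite ltW// conj_weight_gt0.
  have -> : \int[mu]_(x in `]s n, t n]) (conj_weight \_ `]s n, t n]) x = I.
    by rewrite /I /Rintegral; congr fine; apply: eq_integral => x xin; rewrite patchE xin.
  by rewrite divfK// gt_eqF.
Qed.

End filling.

(** * Approximation of an element of the Dirichlet space *)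

Section criterion.
Context {R : realType}.
Local Notation mu := (@lebesgue_measure R).
Variables (p : R) (w : R -> R).
Hypothesis p_gt1 : 1 < p.
Hypothesis w_gt0 : forall t : R, 0 < t -> 0 < w t.
Hypothesis w_cont : {within Rplus, continuous w}.
Implicit Types (f g h u v psi : R -> R) (a b c d x y : R).
Local Notation energy := (weighted_energy p w).
Local Notation conj_weight := (dual_weight p w).
Let mR := @measurable_Rplus R.
Hint Resolve mR : core.

Lemma cvg0_near_le (u_ : nat -> \bar R) (e : R) : 0 < e ->
  u_ n @[n --> \oo] --> 0%E -> \forall n \near \oo, (u_ n <= e%:E)%E.
Proof.
move=> e0 /fine_cvgP[h1 /cvgrPdist_lt /(_ _ e0) h2].
near=> n.
have fn : u_ n \is a fin_num by near: n.
rewrite -(fineK fn) lee_fin; apply: (le_trans (ler_norm _)).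
have : `|0 - (fine \o u_) n| < e by near: n.
by rewrite sub0r normrN => /ltW.
Unshelve. all: by end_near. Qed.

Lemma energy_patch_le f s t : 0 <= s -> measurable_fun Rplus f ->
  (energy (f \_ `]s, t]) <= energy f)%E.
Proof.
move=> s0 mf; apply: energy_le => //; first exact: measurable_patch_oc.
by move=> x _; rewrite patchE; case: ifP; rewrite ?normr0.
Qed.

Lemma energy_tail v : measurable_fun Rplus v -> (energy v < +oo)%E ->
  energy (v \_ `]n.+1%:R^-1, n.+1%:R] \- v)%R @[n --> \oo] --> 0%E.
Proof.
move=> mv vfin; apply: (energy_dominated p_gt1 w_gt0 w_cont _ mv vfin).
- by move=> n; apply: measurable_funB => //; apply: measurable_patch_oc.
- by move=> n x _; rewrite /= patchE; case: ifP => _; rewrite ?subrr ?normr0// sub0r normrN.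
move=> x x0; apply: cvg_near_cst.
have [m hm] := invSn_lt x0.
exists (maxn m (Num.bound x)) => // n /=; rewrite geq_max => /andP[mn xn].
rewrite patchE mem_set ?subrr//= in_itv/=; apply/andP; split.
  by apply: le_lt_trans hm; rewrite lef_pV2 ?posrE// ler_nat.
apply/ltW/(lt_le_trans (archi_boundP (ltW x0))).
by rewrite ler_nat (leq_trans xn).
Qed.

Lemma compact_Rplus_bounds (K : set R) : compact K -> K `<=` Rplus ->
  \forall n \near \oo, forall x, K x -> n.+1%:R^-1 <= x <= n.+1%:R.
Proof.
move=> cK KR; have [->|/set0P [x0 Kx0]] := eqVneq K set0.
  by apply: nearW => n x.
have K0 : K !=set0 by exists x0.
have cid : {within K, continuous (idfun : R -> R)} by apply: continuous_subspaceT => x;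
  exact: cvg_id.
have [y /set_mem Ky ymin] := compact_EVT_min K0 cK cid.
have [z /set_mem Kz zmax] := compact_EVT_max K0 cK cid.
have y0 : 0 < y by have := KR _ Ky; rewrite RplusE.
have z0 : 0 < z by have := KR _ Kz; rewrite RplusE.
have [m hm] := invSn_lt y0.
exists (maxn m (Num.bound z)) => // n /=; rewrite geq_max => /andP[mn zn] x /mem_set Kx.
apply/andP; split.
  apply: le_trans (ymin x Kx); apply: le_trans (ltW hm).
  by rewrite lef_pV2 ?posrE// ler_nat.
apply: le_trans (zmax x Kx) _; apply/ltW/(lt_le_trans (archi_boundP (ltW z0))).
by rewrite ler_nat (leq_trans zn).
Qed.

(** With [a = 1 / (n + 1)] and [b = n + 1] for a large [n], the density [u']
    cut to [(a, b]] is completed by two fillings, one joining [0] to [u a] to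
    the left of [a] and one joining [u b] to [0] to the right of [b]. *)
Lemma approximating_test_function u (e : R) n0 : Dirichlet p w u -> 0 < e ->
  (forall e, 0 < e -> \forall n \near \oo,
    exists s g, 0 < s < n.+1%:R^-1 /\ fills p w e s n.+1%:R^-1 (u n.+1%:R^-1) g) ->
  (forall e, 0 < e -> \forall n \near \oo,
    exists t g, n.+1%:R < t /\ fills p w e n.+1%:R t (- u n.+1%:R) g) ->
  exists phi, [/\ test_function phi,
    (energy (derive1 phi \- derive1 u)%R <= e%:E)%E &
    forall x, n0.+1%:R^-1 <= x <= n0.+1%:R -> `|phi x - u x| <= e].
Proof.
move=> [lac ufin] e0 goodl goodr.
have mv : measurable_fun Rplus (derive1 u) by exact: measurable_derive1_Rplus.
have /wLnorm_lty : (wLnorm p w (derive1 u) < +oo)%E by [].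
move=> /(_ p_gt1 w_gt0) vfin.
set v : R -> R := derive1 u in mv vfin *.
have [eta eta0 H] := test_function_near p_gt1 w_gt0 w_cont e0.
have [K K0 eD] : exists2 K : R, 0 < K & forall f g, measurable_fun Rplus f ->
    measurable_fun Rplus g -> (energy (f \+ g)%R <= K%:E * (energy f + energy g))%E.
  by exists (2 `^ p); [rewrite powR_gt0|exact: energyD].
have [eta' [eta'0 eta'1 eta'2]] : exists eta' : R, [/\ 0 < eta', 2 * eta' <= eta &
    eta' * (K * (K * (1 + 1) + 1)) <= eta].
  have K10 : 0 < K * (K * (1 + 1) + 1) by rewrite mulr_gt0// addr_gt0// mulr_gt0.
  exists (Num.min (eta / 2) (eta / (K * (K * (1 + 1) + 1)))); split.
  - by rewrite lt_min !divr_gt0.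
  - by rewrite mulrC -ler_pdivlMr// ge_min lexx.
  - by rewrite -ler_pdivlMr// ge_min lexx orbT.
have eta'le : eta' <= eta by lra.
near \oo => n.
have nn0 : (n0 <= n)%N by near: n; exact: nbhs_infty_ge.
have n1 : (1 <= n)%N by near: n; exact: nbhs_infty_ge.
have Gl : exists s g, 0 < s < n.+1%:R^-1 /\ fills p w eta' s n.+1%:R^-1 (u n.+1%:R^-1) g.
  by near: n; exact: goodl.
have Gr : exists t g, n.+1%:R < t /\ fills p w eta' n.+1%:R t (- u n.+1%:R) g.
  by near: n; exact: goodr.
have ev : (energy (v \_ `]n.+1%:R^-1, n.+1%:R] \- v)%R <= eta'%:E)%E.
  by near: n; apply: cvg0_near_le => //; exact: energy_tail.
set a : R := n.+1%:R^-1 in Gl ev; set b : R := n.+1%:R in Gr ev.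
have [s [g0 [/andP[s0 sa] [mg0 g00 eg0 ig0]]]] := Gl.
have [t [g1 [bt [mg1 g10 eg1 ig1]]]] := Gr.
have a0 : 0 < a by rewrite invr_gt0.
have b1 : 1 < b by rewrite ltr1n.
have ab : a < b by apply: lt_trans b1; rewrite invf_lt1// ltr1n.
have mvab : measurable_fun Rplus (v \_ `]a, b]) by apply: measurable_patch_oc => //; exact: ltW.
pose h := (g0 \+ g1) \+ v \_ `]a, b].
have mh : measurable_fun Rplus h.
  by apply: measurable_funD => //; exact: measurable_funD.
have fin f (d : R) : (energy f <= d%:E)%E -> (energy f < +oo)%E.
  by move=> h'; apply: le_lt_trans h' _; rewrite ltry.
have vabfin : (energy (v \_ `]a, b]) < +oo)%E.
  by apply: (le_lt_trans _ vfin); apply: energy_patch_le => //; exact: ltW.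
have st : s < t by apply: lt_trans sa (lt_trans ab bt).
have h0 x : x <= s \/ t < x -> h x = 0.
  move=> hx; rewrite /h/= g00 ?g10 ?patchE.
  - rewrite memNset ?addr0//= in_itv/=; case: hx => hx; apply/negP;
    rewrite negb_and -leNgt -ltNge.
      by rewrite (le_trans hx (ltW sa)).
    by rewrite (lt_trans bt hx) orbT.
  - by case: hx => hx; [left; rewrite (le_trans hx)// ltW// (lt_trans sa)|right].
  - by case: hx => hx; [left|right; rewrite (lt_trans ab)// (lt_trans bt)].
have g01 : (energy (g0 \+ g1)%R <= K%:E * (eta'%:E + eta'%:E))%E.
  apply: le_trans (eD _ _ mg0 mg1) _.
  by apply: lee_wpmul2l; [rewrite lee_fin ltW|exact: leeD eg0 eg1].
have g01fin : (energy (g0 \+ g1)%R < +oo)%E.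
  by apply: le_lt_trans g01 _; rewrite -EFinD -EFinM ltry.
have mg01 : measurable_fun Rplus (g0 \+ g1) by exact: measurable_funD.
have hfin : (energy h < +oo)%E.
  apply: le_lt_trans (eD _ _ _ mvab) _; first exact: measurable_funD.
  apply: lte_mul_pinfty; [by rewrite lee_fin ltW|by []|].
  exact: lte_add_pinfty g01fin vabfin.
have hv : (energy (h \- v)%R <= eta%:E)%E.
  have -> : h \- v = (g0 \+ g1) \+ (v \_ `]a, b] \- v) by apply/funext => x; rewrite /h/=; ring.
  apply: le_trans (eD _ _ _ _) _; [exact: measurable_funD|exact: measurable_funB|].
  apply: (@le_trans _ _ (K%:E * (K%:E * (eta'%:E + eta'%:E) + eta'%:E))%E).
    by apply: lee_wpmul2l; [rewrite lee_fin ltW|exact: leeD g01 ev].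
  rewrite [leLHS](_ : _ = (K * (K * (eta' + eta') + eta'))%:E)// lee_fin.
  by apply: le_trans eta'2; rewrite le_eqVlt; apply/orP; left; apply/eqP; ring.
have intg f x : measurable_fun Rplus f -> (energy f < +oo)%E ->
    mu.-integrable `]s, x] (EFin \o f).
  move=> mf ffin; apply: (integrable_of_energy p_gt1 w_gt0 w_cont) => //.
  - by apply: itv_Rplus; exact: ltW.
  - exact: conj_weight_compact_fin.
have hE x : \int[mu]_(r in `]s, x]) h r = \int[mu]_(r in `]s, x]) g0 r +
    \int[mu]_(r in `]s, x]) g1 r + \int[mu]_(r in `]s, x]) (v \_ `]a, b]) r.
  rewrite RintegralD//; [|exact: intg mg01 g01fin|exact: intg mvab vabfin].
  congr (_ + _); apply: RintegralD => //; [exact: intg mg0 (fin _ _ eg0)|exact: intg mg1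
    (fin _ _ eg1)].
have vE x : a <= x <= b -> \int[mu]_(r in `]s, x]) (v \_ `]a, b]) r = u x - u a.
  move=> /andP[ax xb].
  have [_ ->] := locally_ac_ftc lac a0 ax.
  rewrite (@Rintegral_support _ `]a, x]%classic).
  - apply: eq_Rintegral => r; rewrite patchE inE/= in_itv/= => /andP[ar rx].
    by rewrite mem_set//= in_itv/= ar (le_trans rx).
  - by apply: subset_itvr; rewrite bnd_simp ltW.
  move=> r /=; rewrite !in_itv/= => /andP[sr rx] /negP; rewrite rx andbT -leNgt => ra.
  by rewrite patchE memNset//= in_itv/= => /andP[]; rewrite ltNge ra.
have g0E x : a <= x -> \int[mu]_(r in `]s, x]) g0 r = \int[mu]_(r in `]s, a]) g0 r.
  by move=> ax; apply: Rintegral_oc_right => // y ay; apply: g00; right.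
have [||phi [tphi ephi uphi]] := H v u h a b s t s0 (ltW sa) (ltW bt) st mv mh hfin h0 hv.
- move=> x /[dup] /andP[ax xb] /vE xE.
  rewrite hE xE g0E// (_ : \int[mu]_(r in `]s, x]) g1 r = 0); last first.
    rewrite (@Rintegral_support _ set0) ?Rintegral_set0// => r /=;
      rewrite in_itv/= => /andP[_ rx] _.
    by apply: g10; left; exact: le_trans xb.
  rewrite addr0 (_ : _ - _ = \int[mu]_(r in `]s, a]) g0 r - u a); last by ring.
  exact: le_trans ig0 eta'le.
- rewrite hE g0E; last by rewrite ltW// (lt_trans ab).
  rewrite (@Rintegral_support _ `]b, t]%classic _ g1); last 2 first.
  - by apply: subset_itvr; rewrite bnd_simp ltW// (lt_trans sa).
  - move=> r /=; rewrite !in_itv/= => /andP[sr rt] /negP; rewrite rt andbT -leNgt => rb.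
    by apply: g10; left.
  rewrite (@Rintegral_oc_right _ (v \_ `]a, b]) _ b t) ?(ltW bt)//; last first.
    move=> r br; rewrite patchE memNset//= in_itv/= => /andP[_].
    by rewrite leNgt br.
  rewrite vE; last by rewrite lexx ltW.
  rewrite (_ : _ + _ = (\int[mu]_(r in `]s, a]) g0 r - u a) + (\int[mu]_(r in `]b, t]) g1 r
    - - u b)); last by ring.
  apply: le_trans (ler_normD _ _) _; apply: le_trans (lerD ig0 ig1) _.
  by rewrite -mulr2n -mulr_natl.
exists phi; split => // x /andP[x1 x2]; apply: uphi; apply/andP; split.
  by apply: le_trans x1; rewrite lef_pV2 ?posrE// ler_nat.
by apply: le_trans x2 _; rewrite ler_nat.
Unshelve. all: by end_near. Qed.

End criterion.

(** * The closure of the test functions *)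

Section tails.
Context {R : realType}.
Local Notation mu := (@lebesgue_measure R).
Implicit Types (f g h u v psi : R -> R) (a b c d x y : R).

Lemma uniform_cvgP (K : set R) (phi : nat -> R -> R) u :
  {uniform K, phi @ \oo --> u} <->
  forall e : R, 0 < e -> \forall n \near \oo, forall x, K x -> `|u x - phi n x| < e.
Proof.
split => [cv e e0|H].
  have := cv [set h | forall y, K y -> `|u y - h y| < e]; apply.
  apply/uniform_nbhs; exists [set xy | `|xy.1 - xy.2| < e]; split => //.
  rewrite -entourage_ballE; exists e => // -[x y] /=; by rewrite /ball/=.
move=> P /uniform_nbhs [E [entE EP]].
move: entE; rewrite -entourage_ballE => -[e /= e0 eE].
have := H e e0; apply: filterS => n Hn; apply: EP => y Ky; apply: eE.
by rewrite /= /ball/=; exact: Hn.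
Qed.

(** Dominated convergence for the restrictions of [f] to sets that every point
    eventually leaves. *)
Lemma Rintegral_tail_cvg0 (E : set R) (En : nat -> set R) f :
  measurable (E : set (measurableTypeR R)) ->
  (forall n, measurable (En n : set (measurableTypeR R))) ->
  (forall n, En n `<=` E) -> mu.-integrable E (EFin \o f) ->
  (forall x, E x -> \forall n \near \oo, ~ En n x) ->
  \int[mu]_(t in En n) f t @[n --> \oo] --> (0 : R).
Proof.
move=> mE mEn EnE fE out.
have /integrableP[mf _] := fE.
have -> : (fun n => \int[mu]_(t in En n) f t) =
  fine \o (fun n => (\int[mu]_(t in E) ((EFin \o f) \_ (En n)) t)%E).
  by apply/funext => n; rewrite /= -integral_mkcondr setIidr.
apply: fine_cvg.
rewrite [X in _ --> X](_ : _ = (\int[mu]_(t in E) (cst 0 t))%E); last by rewrite integral0.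
apply: (@dominated_cvg _ _ _ mu E mE _ (cst 0%E) (fun t => `|(f t)%:E|)%E) => //.
- move=> n; apply: (@measurable_funTS _ _ _ _ E ((EFin \o f) \_ (En n))).
  have h := measurable_restrictT (EFin \o f) (mEn n).
  by apply: (iffLR h); exact: measurable_funS mE (EnE n) mf.
- move=> x Ex; apply: cvg_near_cst; have := out x Ex; apply: filterS => n nE.
  by rewrite patchE memNset.
- exact: integrable_abse.
- move=> n x Ex; rewrite patchE; case: ifP => //; by rewrite abse0.
Qed.

Lemma derivable_continuous u : (forall x, derivable u x 1) -> continuous u.
Proof. by move=> du x; apply: differentiable_continuous; apply/derivable1_diffP. Qed.

Lemma continuous_ftc u a b : (forall x, derivable u x 1) -> continuous (derive1 u) ->
  a <= b -> mu.-integrable `]a, b] (EFin \o derive1 u) /\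
  u b - u a = \int[mu]_(t in `]a, b]) derive1 u t.
Proof.
move=> du cu'; rewrite le_eqVlt => /predU1P[->|ab].
  by rewrite subrr set_itvoc0 Rintegral_set0; split => //; exact: integrable_set0.
have cu := derivable_continuous du.
have iab : mu.-integrable `[a, b] (EFin \o derive1 u).
  by apply: continuous_compact_integrable; [exact: segment_compact|exact: continuous_subspaceT].
have iab' : mu.-integrable `]a, b] (EFin \o derive1 u).
  apply: integrableS iab; [exact: measurable_itv|exact: measurable_itv|].
  by apply: subset_itvr; rewrite bnd_simp.
split => //; rewrite Rintegral_itv_obnd_cbnd// /Rintegral.
rewrite (continuous_FTC2 ab (continuous_subspaceT cu') (F := u))//.
by split; [|apply: cvg_at_right_filter; exact: cu|apply: cvg_at_left_filter; exact: cu].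
Qed.

(** The derivative is bounded on compact intervals, so [u] is Lipschitz there. *)
Lemma continuous_derive1_locally_ac u : (forall x, derivable u x 1) ->
  continuous (derive1 u) -> locally_abs_continuous u.
Proof.
move=> du cu' a b a0 ab e e0.
have cn : {within `[a, b], continuous (fun x => `|derive1 u x|)}.
  by apply: continuous_subspaceT => x; apply: cvg_norm; exact: cu'.
have [M _ HM] := EVT_max ab cn.
set L := `|derive1 u M| in HM; have L0 : 0 <= L by exact: normr_ge0.
exists (e / (L + 1)); first by rewrite divr_gt0// ltr_wpDl.
move=> n x y xy _ sxy.
apply: (@le_lt_trans _ _ (\sum_(i < n) L * (y i - x i))).
  apply: ler_sum => i _; have [ax xyi yb] := xy i.
  have [|c cxy ->] := @MVT_segment _ u (derive1 u) (x i) (y i) xyi _ (continuous_subspaceT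
    (derivable_continuous du)).
    by move=> z _; split => //; rewrite derive1E.
  rewrite normrM (ger0_norm (x := _ - _)) ?subr_ge0// ler_wpM2r ?subr_ge0//.
  apply: HM; move: cxy; rewrite !in_itv/= => /andP[xc cy].
  by rewrite (le_trans ax xc) (le_trans cy yb).
rewrite -mulr_sumr; apply: (@le_lt_trans _ _ ((L + 1) * \sum_(i < n) (y i - x i))).
  rewrite ler_wpM2r ?lerDl// sumr_ge0// => i _; have [_ h _] := xy i.
  by rewrite subr_ge0.
by rewrite mulrC -ltr_pdivlMr// ltr_wpDl.
Qed.

End tails.

Section inclusions.
Context {R : realType}.
Local Notation mu := (@lebesgue_measure R).
Variables (p : R) (w : R -> R).
Hypothesis p_gt1 : 1 < p.
Hypothesis w_gt0 : forall t : R, 0 < t -> 0 < w t.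
Hypothesis w_cont : {within Rplus, continuous w}.
Implicit Types (f g h u v psi : R -> R) (a b c d x y : R).
Local Notation energy := (weighted_energy p w).
Local Notation conj_weight := (dual_weight p w).
Let mR := @measurable_Rplus R.
Hint Resolve mR : core.

(** The [n]-th test function approximates [u] within [1 / (n + 1)] both in
    norm and uniformly on [[1 / (n + 1), n + 1]]; these intervals exhaust the
    half-line. *)
Lemma Dirichlet0_criterion u : Dirichlet p w u ->
  (forall e, 0 < e -> \forall n \near \oo,
    exists s g, 0 < s < n.+1%:R^-1 /\ fills p w e s n.+1%:R^-1 (u n.+1%:R^-1) g) ->
  (forall e, 0 < e -> \forall n \near \oo,
    exists t g, n.+1%:R < t /\ fills p w e n.+1%:R t (- u n.+1%:R) g) ->
  Dirichlet0 p w u.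
Proof.
move=> Du gl gr; split => //.
pose e_ n : R := Num.min n.+1%:R^-1 (n.+1%:R^-1 `^ p).
have e0 n : 0 < e_ n by rewrite lt_min invr_gt0 ltr0n/= powR_gt0// invr_gt0.
have /choice[phi Hphi] := fun n => approximating_test_function p_gt1 w_gt0 w_cont n Du (e0
  n) gl gr.
exists phi; split.
- by move=> n; have [] := Hphi n.
- apply: (@squeeze_cvge _ _ _ _ (cst 0%E) _ (fun n => (n.+1%:R^-1)%:E)); last 2 first.
  + exact: cvg_cst.
  + exact: cvge_harmonic.
  apply: nearW => n; rewrite poweR_ge0/=; apply/(wLnorm_le p_gt1 w_gt0 _ _).1.
    by rewrite invr_ge0.
  have [_ h _] := Hphi n; apply: le_trans h _.
  by rewrite lee_fin ge_min lexx orbT.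
- move=> K cK KR; apply/uniform_cvgP => e e00.
  have [m hm] := invSn_lt e00.
  have := compact_Rplus_bounds cK KR; move=> [N _ HN].
  exists (maxn m N) => // n /=; rewrite geq_max => /andP[mn Nn] x Kx.
  have [_ _ /(_ x (HN n Nn x Kx))] := Hphi n.
  rewrite distrC => h; apply: le_lt_trans h (le_lt_trans _ hm).
  by rewrite ge_min lef_pV2 ?posrE// ler_nat ltnS mn.
Qed.

Lemma conj_weight_setU (A B : set R) : measurable (A : set (measurableTypeR R)) ->
  measurable (B : set (measurableTypeR R)) -> A `<=` Rplus -> B `<=` Rplus ->
  (\int[mu]_(x in A) (conj_weight x)%:E < +oo)%E ->
  (\int[mu]_(x in B) (conj_weight x)%:E < +oo)%E ->
  (\int[mu]_(x in A `|` B) (conj_weight x)%:E < +oo)%E.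
Proof.
move=> mA mB AR BR Afin Bfin.
have mC E : E `<=` Rplus -> measurable (E : set (measurableTypeR R)) ->
    measurable_fun E (fun x => (conj_weight x)%:E).
  by move=> ER mE; apply/measurable_EFinP; apply: measurable_funS mR ER _;
    exact: measurable_conj_weight.
have C0 x : Rplus x -> (0 <= (conj_weight x)%:E)%E.
  by rewrite RplusE => x0; rewrite lee_fin ltW// conj_weight_gt0.
have ABR : A `|` B `<=` Rplus by move=> x [/AR|/BR].
have -> : A `|` B = A `|` (B `\` A).
  apply/seteqP; split => x; last by case=> [|[]]; [left|right].
  by have [Ax _|nAx] := pselect (A x); [left|case=> // Bx; right].
have mBA : measurable (B `\` A : set (measurableTypeR R)) by exact: measurableD.
have BAR : B `\` A `<=` Rplus by move=> x [/BR].
rewrite ge0_integral_setU//; first last.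
- by apply/disj_setPS => x [Ax [_]].
- by move=> x [/AR|/BAR] Rx; exact: C0.
- by apply: mC; [move=> x [/AR|/BAR]|exact: measurableU].
apply: lte_add_pinfty => //; apply: le_lt_trans Bfin.
apply: ge0_subset_integral => //; [exact: mC|by move=> x /BR; exact: C0].
Qed.

Lemma conj_weight_subset_fin (A B : set R) : measurable (A : set (measurableTypeR R)) ->
  measurable (B : set (measurableTypeR R)) -> A `<=` B -> B `<=` Rplus ->
  (\int[mu]_(x in B) (conj_weight x)%:E < +oo)%E ->
  (\int[mu]_(x in A) (conj_weight x)%:E < +oo)%E.
Proof.
move=> mA mB AB BR; apply: le_lt_trans.
have mC : measurable_fun B (fun x => (conj_weight x)%:E).
  by apply/measurable_EFinP; apply: measurable_funS mR BR _; exact: measurable_conj_weight.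
by apply: (@ge0_subset_integral _ _ _ mu A B mA mB _ mC _ AB) => x _; rewrite lee_fin powR_ge0.
Qed.

Lemma Bp_zero_fin (t : R) : Bp_zero p w -> (\int[mu]_(x in `]0%R, t]) (conj_weight x)%:E <
  +oo)%E.
Proof.
move=> B0; have [t1|t1] := leP t 1.
  apply: (conj_weight_subset_fin _ _ _ _ B0); [exact: measurable_itv|exact: measurable_itv| |].
  - by apply: subset_itvl; rewrite bnd_simp.
  - exact: itv_Rplus.
rewrite (@itv_bndbnd_setU _ _ _ (BRight 1)) ?bnd_simp//; last exact: ltW.
apply: conj_weight_setU; [exact: measurable_itv|exact: measurable_itv
  |exact: itv_Rplus|exact: itv_Rplus|exact: B0|exact: conj_weight_compact_fin].
Qed.

Lemma itvy_Rplus (t : R) : 0 < t -> `[t, +oo[ `<=` (Rplus : set R).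
Proof.
by move=> t0 x /=; rewrite RplusE in_itv/= andbT => tx; exact: lt_le_trans tx.
Qed.

Lemma Bp_infty_fin t : 0 < t -> Bp_infty p w ->
  (\int[mu]_(x in `[t, +oo[) (conj_weight x)%:E < +oo)%E.
Proof.
move=> t0 B0.
have mU : measurable (`]t / 2, 1] `|` `[1%R, +oo[ : set (measurableTypeR R)).
  by apply: measurableU; exact: measurable_itv.
apply: (conj_weight_subset_fin _ mU).
- exact: measurable_itv.
- move=> x /=; rewrite !in_itv/= !andbT => tx; have [x1|x1] := leP x 1; [left|by right;
  exact: ltW].
  by rewrite andbT; apply: lt_le_trans tx; rewrite ltr_pdivrMr// ltr_pMr// ltr1n.
- move=> x [|]; first by apply: itv_Rplus; rewrite divr_ge0// ltW.
  exact: itvy_Rplus.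
apply: conj_weight_setU; [exact: measurable_itv|exact: measurable_itv| | | |exact: B0].
- by apply: itv_Rplus; rewrite divr_ge0// ltW.
- exact: itvy_Rplus.
- by apply: conj_weight_compact_fin => //; rewrite divr_gt0.
Qed.

Lemma not_Bp_zero_divergent a : 0 < a -> ~ Bp_zero p w ->
  (\int[mu]_(x in `]0%R, a]) (conj_weight x)%:E = +oo)%E.
Proof.
move=> a0 nB; apply/eqP; rewrite -leye_eq leNgt; apply/negP => afin; apply: nB.
rewrite /Bp_zero/= -/dual_weight.
have sub : `]0%R, 1%R] `<=` `]0, a] `|` `]a, 1%R].
  move=> x /=; rewrite !in_itv/= => /andP[x0 x1].
  by have [xa|ax] := leP x a; [left; rewrite x0|right].
have U : `]0, a] `|` `]a, 1%R] `<=` (Rplus : set R).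
  by move=> x [|]; apply: itv_Rplus => //; exact: ltW.
have mU : measurable (`]0, a] `|` `]a, 1%R] : set (measurableTypeR R)).
  by apply: measurableU; exact: measurable_itv.
apply: (conj_weight_subset_fin _ mU sub U); first exact: measurable_itv.
apply: conj_weight_setU; [exact: measurable_itv|exact: measurable_itv| | |exact: afin|].
- exact: itv_Rplus.
- by apply: itv_Rplus; exact: ltW.
- exact: conj_weight_compact_fin.
Qed.

Lemma not_Bp_infty_divergent b : 1 <= b -> ~ Bp_infty p w ->
  (\int[mu]_(x in `]b, +oo[) (conj_weight x)%:E = +oo)%E.
Proof.
move=> b1 nB; apply/eqP; rewrite -leye_eq leNgt; apply/negP => afin; apply: nB.
rewrite /Bp_infty/= -/dual_weight.
have b0 : 0 < b by exact: lt_le_trans b1.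
have sub : `[1%R, +oo[ `<=` `]2^-1, b] `|` `]b, +oo[.
  move=> x /=; rewrite !in_itv/= !andbT => x1.
  have [xb|bx] := leP x b; [left|by right].
  by rewrite andbT; apply: lt_le_trans x1; rewrite invf_lt1// ltr1n.
have bR : `]b, +oo[ `<=` (Rplus : set R).
  by apply: subset_trans (itvy_Rplus b0); apply: subset_itvr; rewrite bnd_simp.
have U : `]2^-1, b] `|` `]b, +oo[ `<=` (Rplus : set R).
  by move=> x [|/bR//]; apply: itv_Rplus.
have mU : measurable (`]2^-1, b] `|` `]b, +oo[ : set (measurableTypeR R)).
  by apply: measurableU; exact: measurable_itv.
apply: (conj_weight_subset_fin _ mU sub U); first exact: measurable_itv.
apply: conj_weight_setU; [exact: measurable_itv|exact: measurable_itv| |exact: bR| |exact: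
  afin].
- exact: itv_Rplus.
- by apply: conj_weight_compact_fin => //; rewrite invr_gt0.
Qed.

End inclusions.

(** * Behaviour at the two ends *)

Section eventually_constant.
Context {R : realType}.
Local Notation mu := (@lebesgue_measure R).
Implicit Types (u : R -> R).

Lemma eventually_constant_ftc u (t M l : R) : (forall x, derivable u x 1) ->
  continuous (derive1 u) -> (forall x, M <= x -> u x = l) ->
  mu.-integrable `[t, +oo[ (EFin \o derive1 u) /\
  \int[mu]_(x in `[t, +oo[) derive1 u x = l - u t.
Proof.
move=> du cu' uM; pose T := Num.max t M.
have tT : t <= T by rewrite le_max lexx.
have MT : M <= T by rewrite le_max lexx orbT.
have u'0 x : M < x -> derive1 u x = 0.
  move=> Mx; rewrite derive1E -(near_eq_derive (f := cst l)) ?derive_cst//.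
  by near=> y; rewrite uM// ltW//; near: y; exact: lt_nbhsr.
have mtT : measurable (`[t, T]%classic : set (measurableTypeR R)) by exact: measurable_itv.
have mt : measurable (`[t, +oo[%classic : set (measurableTypeR R)) by exact: measurable_itv.
have it : mu.-integrable `[t, +oo[ (EFin \o derive1 u).
  have : mu.-integrable `[t, T] (EFin \o derive1 u).
    by apply: continuous_compact_integrable; [exact: segment_compact|exact:
      continuous_subspaceT].
  rewrite (integrable_mkcond _ mtT) => h.
  have := integrableS measurableT mt (@subsetT _ _) h.
  apply: eq_integrable => // x; rewrite inE/= in_itv/= andbT => tx.
  rewrite patchE; case: ifPn => //; rewrite notin_setE/= in_itv/= tx/= => /negP.
  by rewrite -ltNge => Tx; rewrite u'0// (le_lt_trans MT).
split => //.
have it' : mu.-integrable `]t, +oo[ (EFin \o derive1 u).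
  apply: integrableS it; [exact: mt|exact: measurable_itv|].
  by apply: subset_itvr; rewrite bnd_simp.
rewrite -Rintegral_itv_obnd_cbnd// (@Rintegral_support _ `]t, T]%classic).
- by have [_ <-] := continuous_ftc du cu' tT; rewrite uM.
- by apply: subset_itvl; rewrite bnd_simp.
- move=> x /=; rewrite !in_itv/= andbT => tx /negP; rewrite tx/= -ltNge => Tx.
  by rewrite u'0// (le_lt_trans MT).
Unshelve. all: by end_near. Qed.

End eventually_constant.

Section ends.
Context {R : realType}.
Local Notation mu := (@lebesgue_measure R).
Variables (p : R) (w : R -> R).
Hypothesis p_gt1 : 1 < p.
Hypothesis w_gt0 : forall t : R, 0 < t -> 0 < w t.
Hypothesis w_cont : {within Rplus, continuous w}.
Implicit Types (f g h u v psi : R -> R) (a b c d x y : R).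
Local Notation energy := (weighted_energy p w).
Local Notation conj_weight := (dual_weight p w).
Let mR := @measurable_Rplus R.
Hint Resolve mR : core.

Definition fillable_zero u := forall e : R, 0 < e -> \forall n \near \oo,
  exists s g, 0 < s < n.+1%:R^-1 /\ fills p w e s n.+1%:R^-1 (u n.+1%:R^-1) g.

Definition fillable_infty u := forall e : R, 0 < e -> \forall n \near \oo,
  exists t g, n.+1%:R < t /\ fills p w e n.+1%:R t (- u n.+1%:R) g.

(** The intervals [(a / (k + 2), a]] exhaust [(0, a]], so their [sigma]-mass
    tends to infinity. *)
Lemma fillable_zero_divergent u : ~ Bp_zero p w -> fillable_zero u.
Proof.
move=> nB e e0; apply: nearW => n; set a : R := n.+1%:R^-1.
have a0 : 0 < a by rewrite invr_gt0.
have s0 k : 0 < a / k.+2%:R by rewrite divr_gt0.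
have [|||k [g fg]] := @fills_divergent _ _ _ p_gt1 w_gt0 w_cont (fun k => a / k.+2%:R) (fun=> a)
    `]0, a]%classic e (u a) e0 s0.
- move=> k m km; apply/subsetPset; apply: subset_itvr; rewrite bnd_simp.
  by rewrite ler_wpM2l ?(ltW a0)// lef_pV2 ?posrE// ler_nat.
- apply/seteqP; split => x.
    move=> [k _] /=; rewrite !in_itv/= => /andP[h ->]; rewrite andbT.
    exact: lt_trans h.
  rewrite /= in_itv/= => /andP[x0 xa].
  have [k hk] : exists k, k.+1%:R^-1 < x / a by apply: invSn_lt; rewrite divr_gt0.
  exists k => //=; rewrite in_itv/= xa andbT.
  rewrite mulrC -ltr_pdivlMr//; apply: le_lt_trans hk.
  by rewrite lef_pV2 ?posrE// ler_nat.
- exact: not_Bp_zero_divergent.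
exists (a / k.+2%:R), g; split => //; rewrite s0/= ltr_pdivrMr//.
by rewrite ltr_pMr// ltr1n.
Qed.

Lemma fillable_infty_divergent u : ~ Bp_infty p w -> fillable_infty u.
Proof.
move=> nB e e0; apply: nearW => n; set b : R := n.+1%:R.
have b1 : 1 <= b by rewrite ler1n.
have b0 : 0 < b by exact: lt_le_trans b1.
have [|||k [g fg]] := @fills_divergent _ _ _ p_gt1 w_gt0 w_cont (fun=> b) (fun k => b + k.+1%:R)
    `]b, +oo[%classic e (- u b) e0 (fun=> b0).
- move=> k m km; apply/subsetPset; apply: subset_itvl; rewrite bnd_simp.
  by rewrite lerD2l ler_nat.
- apply/seteqP; split => x.
    by move=> [k _] /=; rewrite !in_itv/= => /andP[-> _].
  rewrite /= in_itv/= andbT => bx; exists (Num.bound (x - b)) => //=.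
  rewrite in_itv/= bx/= -lerBlDl; apply/ltW/(lt_le_trans (archi_boundP _)).
    by rewrite subr_ge0 ltW.
  by rewrite ler_nat.
- exact: not_Bp_infty_divergent.
by exists (b + k.+1%:R), g; split => //; rewrite ltrDl.
Qed.

Lemma fillable_zero_vanishing u : u n.+1%:R^-1 @[n --> \oo] --> (0 : R) -> fillable_zero u.
Proof.
move=> u0 e e0; move/cvgrPdist_le : u0 => /(_ e e0); apply: filterS => n.
rewrite sub0r normrN => h; exists (n.+1%:R^-1 / 2), (cst 0); split; last exact: fills0.
have a0 : (0 : R) < n.+1%:R^-1 by rewrite invr_gt0.
by rewrite divr_gt0//= ltr_pdivrMr// ltr_pMr// ltr1n.
Qed.

Lemma fillable_infty_vanishing u : u n.+1%:R @[n --> \oo] --> (0 : R) -> fillable_infty u.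
Proof.
move=> u0 e e0; move/cvgrPdist_le : u0 => /(_ e e0); apply: filterS => n.
rewrite sub0r normrN => h; exists (n.+1%:R + 1), (cst 0); split; first by rewrite ltrDl.
by apply: fills0; rewrite ?normrN.
Qed.

Lemma Rzero_vanishing u : Rzero p w u -> u n.+1%:R^-1 @[n --> \oo] --> (0 : R).
Proof.
move=> [_ Hu].
have -> : (fun n : nat => u n.+1%:R^-1) = (fun n : nat => \int[mu]_(t in `]0, n.+1%:R^-1])
  derive1 u t).
  by apply/funext => n; have [|_ ->] := Hu n.+1%:R^-1; rewrite ?invr_gt0.
apply: (@Rintegral_tail_cvg0 _ `]0, 1]%classic).
- exact: measurable_itv.
- by move=> n; exact: measurable_itv.
- by move=> n; apply: subset_itvl; rewrite bnd_simp invf_le1// ler1n.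
- by have [] := Hu 1 ltr01.
move=> x /=; rewrite in_itv/= => /andP[x0 _]; have [m hm] := invSn_lt x0.
exists m => // n /= mn; rewrite in_itv/= => /andP[_ xn].
have nm : n.+1%:R^-1 <= m.+1%:R^-1 :> R by rewrite lef_pV2 ?posrE// ler_nat.
by have := le_lt_trans xn (le_lt_trans nm hm); rewrite ltxx.
Qed.

Lemma Rinfty_vanishing u : Rinfty p w u -> u n.+1%:R @[n --> \oo] --> (0 : R).
Proof.
move=> [_ [v _ Hv]].
have -> : (fun n : nat => u n.+1%:R) = (fun n : nat => \int[mu]_(t in `[n.+1%:R, +oo[) v t).
  by apply/funext => n; have [|_ ->] := Hv n.+1%:R.
apply: (@Rintegral_tail_cvg0 _ `[1, +oo[%classic).
- exact: measurable_itv.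
- by move=> n; exact: measurable_itv.
- by move=> n; apply: subset_itvr; rewrite bnd_simp ler1n.
- by have [] := Hv 1 ltr01.
move=> x /=; rewrite in_itv/= andbT => x1; exists (Num.bound x) => // n /= mn.
rewrite in_itv/= andbT => nx.
have x0 : 0 <= x by apply: le_trans x1.
have bn : (Num.bound x)%:R <= n.+1%:R :> R by rewrite ler_nat leqW.
by have := lt_le_trans (archi_boundP x0) (le_trans bn nx); rewrite ltxx.
Qed.

Lemma test_function_facts phi : @test_function R phi ->
  [/\ forall x, derivable phi x 1, continuous (derive1 phi),
    forall x, x <= 0 -> phi x = 0 & exists M, forall x, M <= x -> phi x = 0].
Proof.
move=> [sphi csupp suppR]; split.
- exact: (sphi 0).
- by apply: derivable_continuous; exact: (sphi 1).
- move=> x x0; apply: contrapT => /eqP nz.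
  have : Rplus x by apply: suppR; apply: subset_closure.
  by rewrite RplusE ltNge x0.
have [M [Mr HM]] := compact_bounded csupp.
exists (`|M| + 1) => x Mx; apply: contrapT => /eqP nz.
have h1 := ler_norm M; have h2 := ler_norm x.
have Mh : M < `|M| + 1 / 2 by lra.
have : `|x| <= `|M| + 1 / 2 by apply: (HM _ Mh); apply: subset_closure.
lra.
Qed.

(** Both boundary conditions at once: [E] is [(0, t]] with sign [1], or [[t,
    +oo)] with sign [-1]. The formula holds for test functions and passes to
    the limit, on the left by convergence at [t], on the right because [sigma]
    is integrable over [E]. *)
Lemma Dirichlet0_limit u (E : set R) t : 0 < t -> Dirichlet0 p w u ->
  measurable (E : set (measurableTypeR R)) -> E `<=` Rplus ->
  (\int[mu]_(x in E) (conj_weight x)%:E < +oo)%E ->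
  forall sgn : R, `|sgn| = 1 ->
  (forall phi, test_function phi -> phi t = sgn * \int[mu]_(x in E) derive1 phi x) ->
  mu.-integrable E (EFin \o derive1 u) /\ u t = sgn * \int[mu]_(x in E) derive1 u x.
Proof.
move=> t0 [[lac ufin] [phi [tphi cvphi unif]]] mE ER Efin sgn sgn1 Hphi.
have mv : measurable_fun Rplus (derive1 u) by exact: measurable_derive1_Rplus.
have vfin : (energy (derive1 u) < +oo)%E by exact/(wLnorm_lty p_gt1 w_gt0).
have iu : mu.-integrable E (EFin \o derive1 u).
  exact: (integrable_of_energy p_gt1 w_gt0 w_cont).
split => //; apply/eqP; rewrite -subr_eq0 -normr_le0; apply/ler_addgt0Pr => e e0.
rewrite add0r.
have e20 : 0 < e / 2 by rewrite divr_gt0.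
have [d d0 Hd] := integral_norm_small p_gt1 w_gt0 w_cont mE ER Efin e20.
have dp0 : 0 < d `^ p^-1 by rewrite powR_gt0.
have KR : [set t] `<=` Rplus by move=> x ->; rewrite RplusE.
have /uniform_cvgP /(_ _ e20) [N1 _ H1] := unif _ (@compact_set1 _ t) KR.
have [N2 _ H2] := cvg0_near_le dp0 cvphi.
pose n := maxn N1 N2.
have h1 : `|u t - phi n t| < e / 2 by apply: H1 => //=; exact: leq_maxl.
have h2 : (energy (derive1 (phi n) \- derive1 u)%R <= d%:E)%E.
  have := (wLnorm_le p_gt1 w_gt0 (derive1 (phi n) \- derive1 u) (ltW dp0)).2 (H2 n
    (leq_maxr _ _)).
  rewrite -powRrM mulVf; last by rewrite gt_eqF// (lt_trans _ p_gt1).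
  by rewrite powRr1// (ltW d0).
have [dphi cphi _ _] := test_function_facts (tphi n).
have mphi : measurable_fun Rplus (derive1 (phi n)).
  by apply: measurable_funTS; exact: continuous_measurable_fun.
have iB := Hd _ (measurable_funB mphi mv) h2.
have iphiB : mu.-integrable E (EFin \o (derive1 (phi n) \- derive1 u)).
  apply/integrableP; split.
    by apply/measurable_EFinP; apply: measurable_funS mR ER _; exact: measurable_funB.
  by apply: le_lt_trans iB _; rewrite ltry.
have iphi : mu.-integrable E (EFin \o derive1 (phi n)).
  have := integrableD mE iphiB iu; apply: eq_integrable => // x _ /=.
  by rewrite -EFinD subrK.
have h3 : `|\int[mu]_(x in E) derive1 (phi n) x - \int[mu]_(x in E) derive1 u x| <= e / 2.
  rewrite -RintegralB// -lee_fin; apply: le_trans iB.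
  apply: (@le_trans _ _ (\int[mu]_(x in E) `|derive1 (phi n) x - derive1 u x|)%:E).
    by rewrite lee_fin; exact: le_normr_Rintegral.
  rewrite /Rintegral fineK//.
  by rewrite ge0_fin_numE; [case/integrableP: iphiB|exact: integral_ge0].
rewrite (splitr e) -[u t](subrK (phi n t)) (Hphi _ (tphi n)) -addrA -mulrBr.
apply: le_trans (ler_normD _ _) _; rewrite normrM sgn1 mul1r; apply: lerD => //.
by rewrite -(Hphi _ (tphi n)) ltW.
Qed.

Lemma Dirichlet0_sub_Rzero : Bp_zero p w -> Dirichlet0 p w `<=` Rzero p w.
Proof.
move=> B0 u Du; split; first by case: Du.
move=> t t0.
have [|iu ut] := @Dirichlet0_limit u `]0, t]%classic t t0 Du (measurable_itv _)
  (itv_Rplus (lexx _)) (Bp_zero_fin p_gt1 w_gt0 w_cont _ B0) 1 (normr1 _).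
  move=> phi /test_function_facts [dphi cphi phi0 _].
  by have [_ <-] := continuous_ftc dphi cphi (ltW t0); rewrite (phi0 0)// subr0 mul1r.
by split => //; rewrite ut mul1r.
Qed.

Lemma Dirichlet0_sub_Rinfty : Bp_infty p w -> Dirichlet0 p w `<=` Rinfty p w.
Proof.
move=> B0 u Du; have DDu : Dirichlet p w u by case: Du.
split => //.
have [lac ufin] := DDu.
exists (\- derive1 u).
  split; first by apply: measurableT_comp => //; exact: measurable_derive1_Rplus.
  by apply/(wLnorm_lty p_gt1 w_gt0); rewrite energyN; exact/(wLnorm_lty p_gt1 w_gt0).
move=> t t0.
have [||iu ut] := @Dirichlet0_limit u `[t, +oo[%classic t t0 Du (measurable_itv _)
  (itvy_Rplus t0) (Bp_infty_fin p_gt1 w_gt0 w_cont t0 B0) (-1).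
- by rewrite normrN normr1.
- move=> phi /test_function_facts [dphi cphi _ [M phiM]].
  have [_ ->] := eventually_constant_ftc t dphi cphi phiM.
  by rewrite sub0r mulN1r opprK.
split; first by have := integrableN iu; exact: eq_integrable.
by rewrite ut -RintegralZl//; apply: eq_Rintegral => x _; rewrite mulN1r.
Qed.

End ends.

(** * Separating examples and the characterization *)

Section separations.
Context {R : realType}.
Local Notation mu := (@lebesgue_measure R).
Variables (p : R) (w : R -> R).
Hypothesis p_gt1 : 1 < p.
Hypothesis w_gt0 : forall t : R, 0 < t -> 0 < w t.
Hypothesis w_cont : {within Rplus, continuous w}.
Implicit Types (f g h u v psi : R -> R) (a b c d x y : R).
Local Notation energy := (weighted_energy p w).
Let mR := @measurable_Rplus R.
Hint Resolve mR : core.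

Lemma smooth_Dirichlet u v : (forall x, is_derive x 1 u (v x)) -> continuous v ->
  (energy v < +oo)%E -> Dirichlet p w u.
Proof.
move=> duv cv vfin.
have du x : derivable u x 1 by have [] := duv x.
have uE : derive1 u = v by apply/funext => x; rewrite derive1E; have [] := duv x.
split; first by apply: continuous_derive1_locally_ac; rewrite ?uE.
by apply/(wLnorm_lty p_gt1 w_gt0); rewrite uE.
Qed.

Lemma not_vanishing u (x_ : nat -> R) : (forall n, (0 < n)%N -> u (x_ n) = 1) ->
  ~ (u (x_ n) @[n --> \oo] --> (0 : R)).
Proof.
move=> u1 u0.
have u1' : u (x_ n) @[n --> \oo] --> (1 : R).
  by apply: cvg_near_cst; exists 1%N => // n /= /u1.
have E : (1 : R) = 0.
  by rewrite -(cvg_lim (@Rhausdorff R) u0) (cvg_lim (@Rhausdorff R) u1').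
by have := oner_neq0 R; rewrite E eqxx.
Qed.

Lemma constant_separates : exists u, [/\ Dirichlet p w u, ~ Rzero p w u & ~ Rinfty p w u].
Proof.
exists (cst 1); split.
- apply: (@smooth_Dirichlet _ (cst 0)).
  + by move=> x; exact: cvg_cst.
  + rewrite (_ : energy _ = 0%E) ?ltry//; apply: integral0_eq => x _.
    by rewrite normr0 powR0 ?mul0r// gt_eqF// (lt_trans _ p_gt1).
- by move=> /Rzero_vanishing; exact: (@not_vanishing (cst 1)).
- by move=> /Rinfty_vanishing; exact: (@not_vanishing (cst 1)).
Qed.

Lemma step_separates : exists u, Rzero p w u /\ ~ Rinfty p w u.
Proof.
have [k ek [dk kfin]] := step1_derive p_gt1 w_gt0 w_cont.
have ck : continuous k by exact/smooth_continuous/elementary_smooth.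
exists (fun x => step (x - 1)); split.
  split; first exact: smooth_Dirichlet dk ck kfin.
  move=> t t0.
  have du x : derivable (fun x : R => step (x - 1)) x 1 by have [] := dk x.
  have uE : derive1 (fun x : R => step (x - 1)) = k.
    by apply/funext => x; rewrite derive1E; have [] := dk x.
  have [|it ut] := continuous_ftc du _ (ltW t0); first by rewrite uE.
  by split => //; rewrite -ut (@step_le0 _ (0 - 1)) ?subr0//; lra.
move=> /Rinfty_vanishing; apply: (@not_vanishing (fun x => step (x - 1)) (fun n => n.+1%:R)).
move=> n n0; rewrite step_ge1// -natr1 addrK ler1n//.
Qed.

Lemma costep_separates : exists u, Rinfty p w u /\ ~ Rzero p w u.
Proof.
have [k ek [dk kfin]] := step1_derive p_gt1 w_gt0 w_cont.
have ck : continuous k by exact/smooth_continuous/elementary_smooth.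
have dS x : derivable (fun x : R => step (x - 1)) x 1 by have [] := dk x.
have SE : derive1 (fun x : R => step (x - 1)) = k.
  by apply/funext => x; rewrite derive1E; have [] := dk x.
exists (cst 1 \- (fun x => step (x - 1))); split.
  split.
    apply: (@smooth_Dirichlet _ (cst 0 \- k)).
    - by move=> x; apply: cvgB; [exact: cvg_cst|exact: ck].
    - rewrite (_ : cst 0 \- k = \- k); first by rewrite energyN.
      by apply/funext => x /=; rewrite sub0r.
  exists k.
    split; last exact/(wLnorm_lty p_gt1 w_gt0).
    by apply: measurable_funTS; exact: continuous_measurable_fun.
  move=> t t0.
  have S1 x : 2 <= x -> step (x - 1) = 1 by move=> x2; rewrite step_ge1//; lra.
  have [|it ut] := eventually_constant_ftc t dS _ S1; first by rewrite SE.
  by rewrite -SE; split => //; rewrite ut.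
move=> /Rzero_vanishing; apply: (@not_vanishing (cst 1 \- (fun x => step (x - 1))) (fun n
  => n.+1%:R^-1)).
move=> n n0; rewrite /= step_le0 ?subr0// subr_le0 invf_le1// ler1n//.
Qed.

End separations.

(** The closure [D0] is known in each of four exclusive and exhaustive cases.
    As [D], [R0], [Ri] and the intersection of the last two are pairwise
    different, its value determines the case. *)
Lemma four_cases_iff (T : Type) (D0 D R0 Ri : set T) (B0 Bi : Prop) (one s c : T) :
  (B0 -> ~ Bi -> D0 = R0) -> (~ B0 -> Bi -> D0 = Ri) ->
  (~ B0 -> ~ Bi -> D0 = D) -> (B0 -> Bi -> D0 = R0 `&` Ri) ->
  D one -> ~ R0 one -> ~ Ri one -> R0 s -> ~ Ri s -> Ri c -> ~ R0 c ->
  [/\ D0 = R0 <-> B0 /\ ~ Bi, D0 = Ri <-> Bi /\ ~ B0,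
      D0 = D <-> ~ (B0 \/ Bi) & D0 = R0 `&` Ri <-> B0 /\ Bi].
Proof.
move=> E1 E2 E3 E4 Done nR0 nRi R0s nRis Ric nR0c.
have R0Ri : R0 <> Ri by move=> h; apply: nRis; rewrite -h.
have R0D : R0 <> D by move=> h; apply: nR0; rewrite h.
have RiD : Ri <> D by move=> h; apply: nRi; rewrite h.
have R0I : R0 <> R0 `&` Ri by move=> h; move: R0s; rewrite h => -[].
have RiI : Ri <> R0 `&` Ri by move=> h; move: Ric; rewrite h => -[].
have DI : D <> R0 `&` Ri by move=> h; move: Done; rewrite h => -[].
have [b0|b0] := pselect B0; have [bi|bi] := pselect Bi.
- by rewrite (E4 b0 bi); split; split; try tauto; move=> h; exfalso;
    [exact: R0I|exact: RiI|exact: DI].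
- by rewrite (E1 b0 bi); split; split; try tauto.
- by rewrite (E2 b0 bi); split; split; try tauto; move=> h; exfalso; exact: R0Ri.
- by rewrite (E3 b0 bi); split; split; try tauto; move=> h; exfalso;
    [exact: R0D|exact: RiD].
Qed.

Theorem theorem4p5 (R : realType) (p : R) (w : R -> R)
    (hp : 1 < p)
    (w_gt0 : forall t : R, 0 < t -> 0 < w t)
    (w_cont : {within Rplus, continuous w}) :
  [/\ Dirichlet0 p w = Rzero p w <-> (Bp_zero p `\` Bp_infty p) w,
      Dirichlet0 p w = Rinfty p w <-> (Bp_infty p `\` Bp_zero p) w,
      Dirichlet0 p w = Dirichlet p w <-> ~ (Bp_zero p `|` Bp_infty p) w &
      Dirichlet0 p w = Rzero p w `&` Rinfty p w <->
        (Bp_zero p `&` Bp_infty p) w].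
Proof.
set D0 := Dirichlet0 p w; set D := Dirichlet p w.
set R0 := Rzero p w; set Ri := Rinfty p w.
have D0D : D0 `<=` D by move=> u [].
have R0D : R0 `<=` D by move=> u [].
have RiD : Ri `<=` D by move=> u [].
have D0R0 := Dirichlet0_sub_Rzero hp w_gt0 w_cont.
have D0Ri := Dirichlet0_sub_Rinfty hp w_gt0 w_cont.
have crit u : D u -> ~ Bp_zero p w \/ R0 u -> ~ Bp_infty p w \/ Ri u -> D0 u.
  move=> Du zero infty; apply: Dirichlet0_criterion => //.
  - by case: zero => [/fillable_zero_divergent|/Rzero_vanishing/fillable_zero_vanishing]; apply.
  - by case: infty => [/fillable_infty_divergent|/Rinfty_vanishing/fillable_infty_vanishing]; apply.
have case1 : Bp_zero p w -> ~ Bp_infty p w -> D0 = R0.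
  move=> B0 nBi; apply/seteqP; split; first exact: D0R0.
  by move=> u R0u; apply: crit; [exact: R0D|right|left].
have case2 : ~ Bp_zero p w -> Bp_infty p w -> D0 = Ri.
  move=> nB0 Bi; apply/seteqP; split; first exact: D0Ri.
  by move=> u Riu; apply: crit; [exact: RiD|left|right].
have case3 : ~ Bp_zero p w -> ~ Bp_infty p w -> D0 = D.
  move=> nB0 nBi; apply/seteqP; split; first exact: D0D.
  by move=> u Du; apply: crit; [|left|left].
have case4 : Bp_zero p w -> Bp_infty p w -> D0 = R0 `&` Ri.
  move=> B0 Bi; apply/seteqP; split; first by move=> u D0u; split; [exact: D0R0|exact: D0Ri].
  by move=> u [R0u Riu]; apply: crit; [exact: R0D|right|right].
have [one [Done nR0 nRi]] := constant_separates hp w_gt0.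
have [s [R0s nRis]] := step_separates hp w_gt0 w_cont.
have [c [Ric nR0c]] := costep_separates hp w_gt0 w_cont.
exact: (four_cases_iff case1 case2 case3 case4 Done nR0 nRi R0s nRis Ric nR0c).
Qed.
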